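(* Consider the monic orthogonal polynomials on $\mathbb R$ with respect to $\exp\big(-N(\frac{z^2}{2}+\frac{uz^6}{6})\big)$, $u>0$, with recurrence $z\mathcal P_n=\mathcal P_{n+1}+\mathcal R_n\mathcal P_{n-1}$, and let $\mathcal R_n\sim\sum_{g\ge0}r_{2g}(x;u)N^{-2g}$, $x=n/N$, be the topological expansion. Then $r_0=\sum_{j=0}^\infty\beta_{0,j}u^j$, $r_2=\sum_{j=1}^\infty\beta_{2,j}u^j$, $r_4=\sum_{j=2}^\infty\beta_{4,j}u^j$, where $\beta_{0,j}=(-10)^j\frac{(3j)!}{j!(2j+1)!}x^{2j+1}$; $\beta_{2,1}=-5x$ and, for $j\ge2$, $\beta_{2,j}=\frac{(-10)^j}{2}x^{2j-1}\Big(10\binom{3j}{j-2}{}_2F_1(3,2-j;3+2j;-2)+\binom{3j}{j-1}{}_2F_1(3,1-j;2+2j;-2)\Big)$; $\beta_{4,2}=295x$, $\beta_{4,3}=-274300x^3$, $\beta_{4,4}=81777000x^5$, and for $j\ge5$, $\beta_{4,j}=\frac{(-10)^j}{20}x^{2j-3}\Big[59\binom{3j}{j-2}{}_2F_1(8,2-j;3+2j;-2)+4011\binom{3j}{j-3}{}_2F_1(8,3-j;4+2j;-2)+27528\binom{3j}{j-4}{}_2F_1(8,4-j;5+2j;-2)+34268\binom{3j}{j-5}{}_2F_1(8,5-j;6+2j;-2)\Big]$.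
   Context: The existence of the topological expansion, with $r_{2g}$ analytic near $(x,u)=(1,0)$, is taken as known. ${}_2F_1(a,b;c;z)=\sum_{k\ge0}\frac{(a)_k(b)_k}{(c)_kk!}z^k$ (Gauss hypergeometric function; here terminating since $b$ is a nonpositive integer). *)

(* Defs.v *)
From HB Require Import structures.
From mathcomp Require Import all_boot all_order all_algebra.
From mathcomp Require Import all_classical all_reals all_analysis.

Set Implicit Arguments.
Unset Strict Implicit.
Unset Printing Implicit Defensive.

Import Order.TTheory GRing.Theory Num.Theory.
Import numFieldNormedType.Exports.

Local Open Scope classical_set_scope.
Local Open Scope ring_scope.

Definition sextic_weight (R : realType) (N : nat) (u z : R) : R :=
  expR (- (N%:R * (z ^+ 2 / 2 + u * z ^+ 6 / 6))).

Definition monic_orthogonal (R : realType) (w : R -> R) (P : nat -> {poly R}) :=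
  (forall n, P n \is monic /\ size (P n) = n.+1) /\
  (forall m n, m <> n ->
     (\int[@lebesgue_measure R]_z ((P m).[z] * (P n).[z] * w z)%R%:E)%E = 0%E).

(* The convention P_(-1) = 0 is used at n = 0, so that rec 0 is arbitrary. *)
Definition recurrence_coefs (R : realType) (P : nat -> {poly R})
    (rec : nat -> R) :=
  forall n, 'X * P n = P n.+1 + rec n *: (if n is m.+1 then P m else 0).

Definition square_sum (R : realType) (a : nat -> nat -> R) (n : nat) : R :=
  \sum_(i < n) \sum_(j < n) a i j.

(* f is, on a box around (x0, u0), the sum of an absolutely convergent double
   power series; absolute convergence makes the use of square partial sums
   immaterial. *)
Definition analytic_near (R : realType) (f : R -> R -> R) (x0 u0 : R) :=
  exists c : nat -> nat -> R, exists2 rho : R, 0 < rho &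
    forall x u, `|x - x0| < rho -> `|u - u0| < rho ->
      let t i j := c i j * (x - x0) ^+ i * (u - u0) ^+ j in
      cvgn (square_sum (fun i j => `|t i j|)) /\
      square_sum t @ \oo --> f x u.

(* rec N u n is the n-th recurrence coefficient for the weight with parameters
   N and u, and r g is the coefficient r_(2g) of N^(-2g).  The remainder is
   uniform in x = n / N near 1, for each fixed small u > 0. *)
Definition topological_expansion (R : realType) (rec : nat -> R -> nat -> R)
    (r : nat -> R -> R -> R) :=
  exists2 delta : R, 0 < delta &
    forall u : R, 0 < u < delta -> forall K : nat,
      exists C : R, exists N0 : nat, forall N n : nat,
        (0 < N)%N -> (N0 <= N)%N -> `|n%:R / N%:R - 1| < delta ->
        `|rec N u n - \sum_(g < K.+1) r g (n%:R / N%:R) u * N%:R ^- (2 * g)|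
          <= C * N%:R ^- (2 * K.+1).

Definition pochhammer (R : realType) (a : R) (k : nat) : R :=
  \prod_(i < k) (a + i%:R).

Definition hyp2F1 (R : realType) (a b c z : R) : R :=
  limn (series (fun k =>
    pochhammer a k * pochhammer b k / (pochhammer c k * k`!%:R) * z ^+ k)).

Definition beta0 (R : realType) (j : nat) (x : R) : R :=
  (- 10) ^+ j * ((3 * j)`!%:R / (j`!%:R * (2 * j + 1)`!%:R)) * x ^+ (2 * j + 1).

(* Meaningful for j >= 1. *)
Definition beta2 (R : realType) (j : nat) (x : R) : R :=
  if j == 1%N then - 5 * x
  else (- 10) ^+ j / 2 * x ^+ (2 * j - 1) *
    (10 * 'C(3 * j, j - 2)%:R * hyp2F1 3 (2 - j%:R) (3 + 2 * j%:R) (- 2)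
     + 'C(3 * j, j - 1)%:R * hyp2F1 3 (1 - j%:R) (2 + 2 * j%:R) (- 2)).

(* Meaningful for j >= 2.  Since ring literals unfold to unary naturals, the
   constants 274300, 81777000, 4011, 27528 and 34268 are written in base 10^3. *)
Definition beta4 (R : realType) (j : nat) (x : R) : R :=
  if j == 2%N then 295 * x
  else if j == 3%N then - (274 * 10 ^+ 3 + 300) * x ^+ 3
  else if j == 4%N then (81 * 10 ^+ 6 + 777 * 10 ^+ 3) * x ^+ 5
  else (- 10) ^+ j / 20 * x ^+ (2 * j - 3) *
    (59 * 'C(3 * j, j - 2)%:R * hyp2F1 8 (2 - j%:R) (3 + 2 * j%:R) (- 2)
     + (4 * 10 ^+ 3 + 11) * 'C(3 * j, j - 3)%:R
         * hyp2F1 8 (3 - j%:R) (4 + 2 * j%:R) (- 2)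
     + (27 * 10 ^+ 3 + 528) * 'C(3 * j, j - 4)%:R
         * hyp2F1 8 (4 - j%:R) (5 + 2 * j%:R) (- 2)
     + (34 * 10 ^+ 3 + 268) * 'C(3 * j, j - 5)%:R
         * hyp2F1 8 (5 - j%:R) (6 + 2 * j%:R) (- 2)).

(* Main.v *)
(* Integrating derivatives against the weight and using the three-term
   recurrence gives the string equation
     n / N = R_n (1 + u Q(R_(n-2), ..., R_(n+2))).
   Inserting the topological expansion at a rational point x = n / N and letting
   N tend to infinity along its multiples, the orders N^0, N^-2 and N^-4 give
   algebraic equations for y = r_0, r_2 and r_4; the Taylor coefficients of r_0
   and r_2 that occur are explicit, since y + 10 u y^3 = x determines y.
   Continuity in x extends the equations to all real x near 1.
   For fixed x, put w = - 10 x^2 u and y = x (1 + T), so that T = w (1 + T)^3.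
   Then 2 x r_2 and 20 x^3 r_4 are integer combinations of the functions
   T^m (1 + T) / (1 - 2 T)^(a+1).  For a = 0 the coefficient of w^j in such a
   function is 'C(3j, j - m) by Pascal's rule, and dividing by 1 - 2 T raises a,
   which turns it into a terminating 2F1 at -2.  Uniqueness of asymptotic
   expansions as u -> 0+ identifies the power series of the r_2g in u. *)
Require Import Defs.
From HB Require Import structures.
From mathcomp Require Import all_boot all_order all_algebra.
From mathcomp Require Import all_classical all_reals all_analysis.
From mathcomp Require Import measurable_realfun zify ring lra.
Set Implicit Arguments.
Unset Strict Implicit.
Unset Printing Implicit Defensive.
Import Order.TTheory GRing.Theory Num.Theory.
Import numFieldNormedType.Exports.
Local Open Scope classical_set_scope.
Local Open Scope ring_scope.

(** The hypotheses control the expansion separately for each [u > 0], with no uniformity in [u], and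
    say nothing about the recurrence coefficients for [u <= 0]. The limit in N is therefore taken at
    fixed [u], and only its outcome, equations between the r_2g, is sent to [u -> 0+]. Nonpositive
    [u] is reached at the very end, through the power series. Derivatives in x are never formed: the
    neighbour R_(n+k) sits at x + k/N, and the expansions of r_0 and r_2 there are read off their
    own algebraic equations. This is why each equation is extended to all points near 1 before the
    next order is attacked. Both limits use one notion, [asym]: equality with a polynomial in t up
    to o(t^n) along a filter, for t = 1/N and then for t = - 10 x^2 u. The numbers 59, 4011, 27528,
    34268 appear when the order N^-4 is written homogeneously in 1 + v and v, where v = 10 u r_0^2:
    since v = - T / (1 + T) and 1 + v = 1 / (1 + T), all terms get the same denominator and all
    signs become positive. *)

(** * Integrals against the weight: integrability, definiteness, integration by parts *)

Section SexticWeight.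
Context (R : realType).
Implicit Types (p q : {poly R}) (z : R).
Local Notation mu := (@lebesgue_measure R).

Variables (N : nat) (u : R).
Hypotheses (N0 : (0 < N)%N) (u0 : 0 < u).
Local Notation w := (sextic_weight N u).

Lemma sextic_weight_gt0 z : 0 < w z.
Proof. exact: expR_gt0. Qed.

Lemma sextic_weight_is_derive z :
  is_derive z 1 w (- (N%:R * (z + u * z ^+ 5)) * w z).
Proof.
rewrite /sextic_weight.
apply: is_derive_eq.
by rewrite /GRing.scale/=; field.
Qed.

(** This bounds the weight by a constant times exp(-2 z^2): one factor exp(-z^2) will absorb a
    monomial, the other is the integrable majorant. With s = z^2, either s < 1 + 2/v and the
    right-hand constant covers 2 s, or v s >= 2 and s >= 1, so that v s^3 >= 2 s. *)
Lemma sextic_exponent_bound z (v : R) : 0 < v ->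
  - (2 * (1 + 2 / v)) <= v * z ^+ 6 - 2 * z ^+ 2.
Proof.
move=> v0.
have -> : z ^+ 6 = (z ^+ 2) ^+ 3 by rewrite -exprM.
have : 0 <= z ^+ 2 by exact: sqr_ge0.
move: (z ^+ 2) => s s0.
have h2 : 0 < 2 / v by rewrite divr_gt0.
have [hs|hs] := leP (1 + 2 / v) s; last first.
  have : 0 <= v * s ^+ 3 by rewrite mulr_ge0 ?exprn_ge0// ltW.
  by lra.
have vs : 2 <= v * s.
  have -> : 2 = v * (2 / v) by field; rewrite gt_eqF.
  by rewrite ler_pM2l//; lra.
have s1 : 1 <= s by lra.
have : 2 * s <= v * s ^+ 3.
  have -> : v * s ^+ 3 = (v * s) * s ^+ 2 by ring.
  have : s <= s ^+ 2 by rewrite expr2; nra.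
  by nra.
by lra.
Qed.

Lemma monomial_le_gauss k : exists C, forall z, `|z ^+ k| * w z <= C * gauss_fun z.
Proof.
pose v : R := N%:R * u / 6.
have v0 : 0 < v by rewrite /v !mulr_gt0 ?ltr0n.
pose C1 := 2 * (1 + 2 / v).
exists ((1 + k`!%:R) * expR C1) => z.
have N1 : (1 : R) <= N%:R by rewrite ler1n.
have hw : w z <= expR C1 * expR (- z ^+ 2) * expR (- z ^+ 2).
  rewrite -!expRD ler_expR.
  have := sextic_exponent_bound z v0; rewrite -/C1 /v.
  have := sqr_ge0 z; nra.
have hk : `|z ^+ k| * expR (- z ^+ 2) <= 1 + k`!%:R.
  rewrite expRN -ler_pdivlMr ?invr_gt0 ?expR_gt0// invrK.
  have e1 : 1 <= expR (z ^+ 2) by rewrite -expR0 ler_expR sqr_ge0.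
  have kk : (z ^+ 2) ^+ k <= k`!%:R * expR (z ^+ 2).
    case: k => [|k]; first by rewrite expr0 fact0 mul1r.
    have := expR_ge1Dxn k (sqr_ge0 z).
    move=> e2; rewrite mulrC -ler_pdivrMr ?ltr0n ?fact_gt0//.
    apply: le_trans e2.
    by rewrite lerDr.
  have : `|z ^+ k| <= 1 + (z ^+ 2) ^+ k.
    rewrite -exprM mulnC exprM -(ger0_norm (sqr_ge0 (z ^+ k))) [`|_ ^+ 2|]normrX.
    have := normr_ge0 (z ^+ k); move: `|z ^+ k| => a; nra.
  nra.
rewrite /gauss_fun.
apply: (@le_trans _ _ (`|z ^+ k| * (expR C1 * expR (- z ^+ 2) * expR (- z ^+ 2)))).
  by rewrite ler_wpM2l.
have -> : `|z ^+ k| * (expR C1 * expR (- z ^+ 2) * expR (- z ^+ 2)) =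
  (`|z ^+ k| * expR (- z ^+ 2)) * (expR C1 * expR (- z ^+ 2)) by ring.
by rewrite -(mulrA _ (expR C1)) ler_wpM2r// mulr_ge0 ?expR_ge0.
Qed.

Lemma poly_le_gauss p : exists C, forall z, `|p.[z] * w z| <= C * gauss_fun z.
Proof.
have [C hC] := choice monomial_le_gauss.
exists (\sum_(i < size p) `|p`_i| * C i) => z.
rewrite normrM (gtr0_norm (sextic_weight_gt0 z)) horner_coef.
apply: (le_trans (ler_wpM2r (ltW (sextic_weight_gt0 z)) (ler_norm_sum _ _ _))).
rewrite !mulr_suml; apply: ler_sum => i _.
by rewrite normrM -!mulrA ler_wpM2l.
Qed.

Lemma continuous_sextic_weight : continuous w.
Proof.
move=> z; apply: differentiable_continuous; apply/derivable1_diffP.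
by have [] := sextic_weight_is_derive z.
Qed.

Lemma continuous_poly_weight p : continuous (fun z => p.[z] * w z).
Proof.
move=> z; apply: cvgM; first exact: continuous_horner.
exact: continuous_sextic_weight.
Qed.

Lemma measurable_poly_weight p :
  measurable_fun [set: R] (EFin \o (fun z => p.[z] * w z)).
Proof.
apply/measurable_EFinP; apply: continuous_measurable_fun.
exact: continuous_poly_weight.
Qed.

Lemma integrable_poly_weight p :
  mu.-integrable [set: R] (EFin \o (fun z => p.[z] * w z)).
Proof.
have [C hC] := poly_le_gauss p.
apply: (@le_integrable _ _ _ mu _ measurableT _ (fun x => C%:E * (gauss_fun x)%:E)%E).
- exact: measurable_poly_weight.
- move=> z _; rewrite /comp -EFinM !abse_EFin lee_fin.
  exact: le_trans (hC z) (ler_norm _).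
- by apply: integrableZl => //; exact: integrableT_gauss.
Qed.

Definition weight_int p : R := (\int[mu]_z (p.[z] * w z))%R.

Lemma weight_intD p q : weight_int (p + q) = weight_int p + weight_int q.
Proof.
rewrite /weight_int -RintegralD//; try exact: integrable_poly_weight.
by apply: eq_Rintegral => z _; rewrite hornerD mulrDl.
Qed.

Lemma weight_intZ (a : R) p : weight_int (a *: p) = a * weight_int p.
Proof.
rewrite /weight_int -RintegralZl//; last exact: integrable_poly_weight.
by apply: eq_Rintegral => z _; rewrite hornerZ mulrA.
Qed.

(** If the integral of p^2 w vanishes, then p vanishes outside a null set. A nonzero p has finitely
    many roots, so the line would be the union of two null sets. *)
Lemma weight_int_sqr_neq0 p : p != 0 -> weight_int (p * p) != 0.
Proof.
move=> p0; apply/eqP => h0.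
have : (\int[mu]_z `|((p * p).[z] * w z)%:E| = 0)%E.
  have := integrable_fin_num measurableT (integrable_poly_weight (p * p)).
  move: h0; rewrite /weight_int /Rintegral.
  under [in X in _ -> _ -> X]eq_integral => z _.
    rewrite /= ger0_norm; last first.
      by rewrite mulr_ge0 ?(ltW (sextic_weight_gt0 z))// hornerM -expr2 sqr_ge0.
    over.
  by move=> /= h0 /fineK <-; rewrite h0.
move/(ae_eq_integral_abs mu measurableT (measurable_poly_weight (p * p))).
case=> /= A [mA A0 sA].
have rootsA : ~` A `<=` [set z | root p z].
  move=> z Az; apply/rootP; apply: contrapT => pz; apply: Az; apply: sA => /=.
  move=> /(_ I) [] /eqP.
  have /gt_eqF w0 := sextic_weight_gt0 z.
  by rewrite hornerM !mulf_eq0 w0 orbF orbb => /eqP.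
have finA : finite_set (~` A).
  apply: sub_finite_set rootsA _; apply: contrapT => inf.
  have [B BA sB] := infinite_set_fset (size p) inf.
  have : (size (finmap.enum_fset B) < size p)%N.
    apply: max_poly_roots => //; last exact: finmap.fset_uniq.
    by apply/allP => z zB; exact: (BA z zB).
  by rewrite ltnNge sB.
have A'0 := countable_lebesgue_measure0 (finite_set_countable finA).
have : (mu (A `|` ~` A) <= mu A + mu (~` A))%E.
  by apply: measureU2 => //; exact: measurableC.
rewrite A0 A'0 adde0 setUv.
have -> : [set: R] = [set` (`]-oo, +oo[ : interval R)] by rewrite set_itvNyy.
by rewrite lebesgue_measure_itv.
Qed.

(** With q = p' - N (X + u X^5) p, the function q w is the derivative of p w. Its integral over
    growing intervals is a boundary term that the Gaussian bound sends to 0, and dominated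
    convergence passes to the line. *)
Lemma weight_int_deriv p :
  weight_int p^`() = N%:R * weight_int (('X + u *: 'X^5) * p).
Proof.
apply/eqP; rewrite -subr_eq0 -weight_intZ -[X in _ - X]mul1r -mulNr -weight_intZ -weight_intD.
set q := _ + _.
have dF z : is_derive z 1 (fun z => p.[z] * w z) (q.[z] * w z).
  have := sextic_weight_is_derive z => ?.
  apply: is_derive_eq.
  rewrite /q /GRing.scale/= !hornerE /=; ring.
have [C hC] := poly_le_gauss p.
have [C' hC'] := poly_le_gauss q.
(* The successor keeps the endpoints distinct at n = 0, as the fundamental theorem of calculus
   requires. *)
pose D n := `[(- n.+1%:R : R), n.+1%:R]%classic.
have int_n n : (\int[mu]_(z in D n) (q.[z] * w z)%:E =
   (p.[n.+1%:R] * w n.+1%:R)%:E - (p.[- n.+1%:R] * w (- n.+1%:R))%:E)%E.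
  apply: (@continuous_FTC2 _ (fun z => q.[z] * w z) (fun z => p.[z] * w z)).
  - by rewrite gtrN.
  - by apply: continuous_subspaceT; exact: continuous_poly_weight.
  - split.
    + by move=> x _; have [] := dF x.
    + by apply: cvg_at_right_filter; exact: continuous_poly_weight.
    + by apply: cvg_at_left_filter; exact: continuous_poly_weight.
  - by move=> x _; rewrite derive1E; have [_ ->] := dF x.
pose f_ n := (EFin \o (fun z => q.[z] * w z)) \_ (D n).
have [_ _] : [/\ mu.-integrable [set: R] (EFin \o (fun z => q.[z] * w z)),
  [sequence (\int[mu]_x `|f_ n x - (q.[x] * w x)%:E|)%E]_n @ \oo --> 0%E &
  [sequence (\int[mu]_x f_ n x)%E]_n @ \oo --> (\int[mu]_x (q.[x] * w x)%:E)%E].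
  apply: (@dominated_convergence _ _ _ mu _ measurableT f_ _
    (fun x => C'%:E * (gauss_fun x)%:E)%E).
  - move=> n; apply/(measurable_restrictT _ _).1; first exact: measurable_itv.
    by apply: measurable_funTS; exact: measurable_poly_weight.
  - exact: measurable_poly_weight.
  - apply: aeW => z _; apply: cvg_near_cst.
    exists (Num.bound `|z|) => // n /= zn.
    rewrite /f_ patchE mem_set// /D/= in_itv/= -ler_norml.
    apply: (le_trans (ltW (archi_boundP (normr_ge0 z)))).
    by rewrite ler_nat leqW.
  - by apply: integrableZl => //; exact: integrableT_gauss.
  - apply: aeW => z n _; rewrite /f_ patchE.
    case: ifP => _ /=; first by rewrite -EFinM lee_fin.
    by rewrite normr0 -EFinM lee_fin (le_trans _ (hC' z)).
have bound0 : (p.[n.+1%:R] * w n.+1%:R - p.[- n.+1%:R] * w (- n.+1%:R))%:E @[n --> \oo] --> 0%E.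
  apply/fine_cvgP; split; first exact: nearW.
  apply: norm_cvg0.
  have g0 : 2 * C * gauss_fun (n.+1%:R : R) @[n --> \oo] --> (0 : R).
    rewrite -[X in _ --> X](mulr0 (2 * C)); apply: cvgMr.
    apply: (cvg_comp (fun n : nat => n.+1%:R : R)); last exact: cvg_gauss_fun.
    by have := @cvgr_idn R; rewrite -cvg_shiftS.
  apply: (@squeeze_cvgr _ _ _ _ (cst 0) (fun n => 2 * C * gauss_fun (n.+1%:R : R))) => //.
    apply: nearW => n /=; rewrite normr_ge0/=.
    apply: (le_trans (ler_normB _ _)).
    rewrite mulrDl mul1r mulrDl lerD//.
    by rewrite (le_trans (hC _))// /gauss_fun sqrrN.
  exact: cvg_cst.
under eq_fun => n do rewrite /= -integral_mkcond int_n.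
move=> h; apply/eqP; rewrite /weight_int /Rintegral.
have := cvg_unique _ h bound0.
by move=> ->.
Qed.
End SexticWeight.

(** * The string equation for an abstract moment functional [L] *)

Section OrthogonalPolynomials.
Context (R : realType) (L : {poly R} -> R) (P : nat -> {poly R}) (rec : nat -> R).
Implicit Types p q : {poly R}.
Hypotheses (LD : forall p q, L (p + q) = L p + L q)
  (LZ : forall a p, L (a *: p) = a * L p)
  (L_sqr : forall p, p != 0 -> L (p * p) != 0)
  (P_size : forall n, P n \is monic /\ size (P n) = n.+1)
  (P_orth : forall m n, m <> n -> L (P m * P n) = 0)
  (P_rec : recurrence_coefs P rec).

Let h n := L (P n * P n).

Let h_neq0 n : h n != 0.
Proof. by apply: L_sqr; rewrite -size_poly_eq0 (P_size n).2. Qed.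

Let L0 : L 0 = 0.
Proof. by rewrite -(scale0r (0 : {poly R})) LZ mul0r. Qed.

Lemma orthogonal_lower_degree n q : (size q <= n)%N -> L (P n * q) = 0.
Proof.
have [k] := ubnP (size q); elim: k q => // k IH q; rewrite ltnS => sqk sqn.
have [->|q0] := eqVneq q 0; first by rewrite mulr0 L0.
pose m := (size q).-1.
have sq : size q = m.+1 by rewrite /m prednK// lt0n size_poly_eq0.
have [Pm sPm] := P_size m.
have szq' : (size (q - lead_coef q *: P m)%R < size q)%N.
  rewrite sq ltnS; apply/leq_sizeP => j mj.
  rewrite coefB coefZ; move: mj; rewrite leq_eqVlt => /predU1P[<-|mj].
    have := monicP Pm; rewrite /lead_coef sPm sq /= => ->.
    by rewrite mulr1 subrr.
  by rewrite !nth_default ?mulr0 ?subrr// ?sPm ?sq.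
have -> : q = (q - lead_coef q *: P m) + lead_coef q *: P m by rewrite subrK.
rewrite mulrDr LD -scalerAr LZ IH ?P_orth ?mulr0 ?addr0//.
- by move=> nm; move: sqn; rewrite sq nm ltnn.
- exact: leq_trans szq' sqk.
- exact: ltnW (leq_trans szq' sqn).
Qed.

(** Multiplication by ['X] is symmetric for [L]: moving it from one factor to the other and
    expanding by the recurrence leaves one square norm on each side. *)
Lemma rec_norm n : rec n.+1 * h n = h n.+1.
Proof.
have : L ('X * P n.+1 * P n) = L (P n.+1 * ('X * P n)).
  by congr (L _); rewrite mulrAC mulrC.
rewrite !P_rec mulrDl mulrDr !LD -scalerAl LZ P_orth; last by lia.
rewrite add0r => ->; rewrite /h.
case: n => [|n]; first by rewrite scaler0 mulr0 L0 addr0.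
by rewrite -scalerAr LZ (@P_orth n.+2 n) ?mulr0 ?addr0//; lia.
Qed.

Lemma deriv_top n : L ((P n.+1)^`() * P n) = n.+1%:R * h n.
Proof.
have [Pm sPm] := P_size n.+1; have [Pn sPn] := P_size n.
have s' : (size ((P n.+1)^`() - n.+1%:R *: P n)%R <= n)%N.
  apply/leq_sizeP => j mj.
  rewrite coefB coefZ coef_deriv; move: mj; rewrite leq_eqVlt => /predU1P[<-|mj].
    have := monicP Pm; rewrite /lead_coef sPm /= => ->.
    by have := monicP Pn; rewrite /lead_coef sPn /= => ->; rewrite mulr1 subrr.
  by rewrite !nth_default ?mulr0 ?mul0rn ?subrr// ?sPm ?sPn.
have -> : (P n.+1)^`() = ((P n.+1)^`() - n.+1%:R *: P n) + n.+1%:R *: P n by rewrite subrK.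
by rewrite mulrDl LD -scalerAl LZ mulrC orthogonal_lower_degree// add0r.
Qed.

Variables (N : nat) (u : R).
Hypothesis (N0 : (0 < N)%N).
Hypothesis L_deriv : forall p, L p^`() = N%:R * L (('X + u *: 'X^5) * p).

(** The arguments are R_(n-2), ..., R_(n+2) in this order. Multiplied by R_n, the ten monomials are
    the weights of the paths of five unit steps from height n to n - 1, that is, the coefficient of
    P_(n-1) in X^5 P_n. Their number is the 10 in y + 10 u y^3. *)
Definition string_sum (a2 a1 b c1 c2 : R) : R :=
  c1 * (b + c1 + c2) + (a1 + b + c1) * (b + a1) + a1 * a2.

(** The index starts at 3 so that only R_1, R_2, ... occur and the arbitrary value [rec 0] stays
    out. Sharing X^5 as X^3 and X^2 between the two polynomials keeps the expansions short; they
    have only P_(n+4), P_(n+2) and P_n in common. *)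
Lemma string_equation n :
  n.+3%:R / N%:R = rec n.+3 *
    (1 + u * string_sum (rec n.+1) (rec n.+2) (rec n.+3) (rec n.+4) (rec n.+4.+1)).
Proof.
have PrecS k : 'X * P k.+1 = P k.+2 + rec k.+1 *: P k by rewrite P_rec.
have LX : L ('X * (P n.+3 * P n.+2)) = rec n.+3 * h n.+2.
  rewrite mulrA PrecS mulrDl LD -scalerAl LZ P_orth ?add0r//; lia.
have PrecC k : 'X * P k.+1 = P k.+2 + (rec k.+1)%:P * P k by rewrite PrecS mul_polyC.
have X2 : 'X^2 * P n.+2 = P n.+4 + (rec n.+3 + rec n.+2) *: P n.+2
    + (rec n.+2 * rec n.+1) *: P n.
  rewrite -!mul_polyC !(polyCD, polyCM).
  have -> : 'X^2 * P n.+2 = 'X * ('X * P n.+2) by ring.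
  by rewrite PrecC mulrDr (mulrCA 'X) !PrecC; ring.
have X3 : 'X^3 * P n.+3 = P n.+4.+2 + (rec n.+3 + rec n.+4 + rec n.+4.+1) *: P n.+4
   + (rec n.+3 * (rec n.+2 + rec n.+3 + rec n.+4)) *: P n.+2
   + (rec n.+3 * rec n.+2 * rec n.+1) *: P n.
  rewrite -!mul_polyC !(polyCD, polyCM).
  have -> : 'X^3 * P n.+3 = 'X * ('X * ('X * P n.+3)) by ring.
  rewrite PrecC mulrDr (mulrCA 'X) !PrecC.
  rewrite !(mulrDr, mulrCA 'X) !PrecC; ring.
have LX5 : L ('X^5 * (P n.+3 * P n.+2)) = rec n.+3 * h n.+2 *
    string_sum (rec n.+1) (rec n.+2) (rec n.+3) (rec n.+4) (rec n.+4.+1).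
  have -> : 'X^5 * (P n.+3 * P n.+2) = ('X^3 * P n.+3) * ('X^2 * P n.+2) by ring.
  rewrite X2 X3 !(mulrDl, mulrDr) -!scalerAl -!scalerAr !LD !LZ.
  rewrite !(@P_orth n.+4.+2) ?(@P_orth n.+4 n.+2) ?(@P_orth n.+4 n); try lia.
  rewrite ?(@P_orth n.+2 n.+4) ?(@P_orth n.+2 n) ?(@P_orth n n.+4) ?(@P_orth n n.+2); try lia.
  rewrite -!/(h _) /string_sum.
  have -> : h n.+4 = rec n.+4 * rec n.+3 * h n.+2 by rewrite -!rec_norm mulrA.
  have -> : h n.+2 = rec n.+2 * rec n.+1 * h n by rewrite -!rec_norm mulrA.
  by rewrite /GRing.scale/=; ring.
(* Both sides are [L] of P_(n+3)' P_(n+2). On the right it is [L] of the derivative of the product,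
   since P_(n+3) is orthogonal to P_(n+2)'. *)
have key : n.+3%:R * h n.+2 = N%:R * (L ('X * (P n.+3 * P n.+2))
     + u * L ('X^5 * (P n.+3 * P n.+2))).
  rewrite -deriv_top -LZ -LD scalerAl -mulrDl -L_deriv derivM LD.
  rewrite [X in _ = _ + X]orthogonal_lower_degree ?addr0//.
  have /lt_size_deriv : P n.+2 != 0 by rewrite -size_poly_eq0 (P_size _).2.
  by rewrite (P_size _).2 => /ltnW.
have Nn0 : (N%:R : R) != 0 by rewrite pnatr_eq0 -lt0n.
apply: (mulIf (h_neq0 n.+2)); apply: (mulfI Nn0).
rewrite mulrAC mulrCA key LX LX5; by field.
Qed.
End OrthogonalPolynomials.

(** * Calculus of finite asymptotic expansions along a filter *)

Section AsymptoticExpansions.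
Context (R : realType) (T : Type) (F : set_system T) {FF : ProperFilter F}.
Context (t : T -> R) (t0 : t @ F --> (0 : R)) (tN0 : \forall m \near F, t m != 0).
Implicit Types (f g : T -> R) (p q : {poly R}) (n : nat).

(** Coefficients of [p] beyond degree [n] carry no information. Products can thus be left
    untruncated, and [asym_trunc] exchanges polynomials that agree up to degree [n]. *)
Definition asym n f p := (f m - p.[t m]) / t m ^+ n @[m --> F] --> (0 : R).

Lemma cvg_near_eq f g (a b : R) : f @ F --> a -> a = b ->
  (\forall m \near F, f m = g m) -> g @ F --> b.
Proof. by move=> fa <- fg; apply: cvg_trans fa; exact: near_eq_cvg. Qed.

Lemma cvg_horner_t p : p.[t m] @[m --> F] --> p.[0].
Proof. by apply: (cvg_comp t); [exact: t0|exact: continuous_horner]. Qed.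

Lemma asym_near n f g p : (\forall m \near F, f m = g m) ->
  asym n f p -> asym n g p.
Proof.
move=> fg; apply: cvg_trans; apply: near_eq_cvg.
by apply: filterS fg => m ->.
Qed.

Lemma asymP n f p : asym n f p <->
  exists2 e : T -> R, e @ F --> (0 : R) &
    \forall m \near F, f m = p.[t m] + t m ^+ n * e m.
Proof.
split=> [fp|[e e0 fe]].
  exists (fun m => (f m - p.[t m]) / t m ^+ n) => //.
  apply: filterS tN0 => m tm; field.
  by rewrite ?expf_neq0.
apply: cvg_trans e0; apply: near_eq_cvg.
apply: filterS2 tN0 fe => m tm ->; field.
by rewrite ?expf_neq0.
Qed.

Lemma asym0P f p : asym 0 f p <-> f @ F --> p`_0.
Proof.
rewrite /asym -horner_coef0; split => h; last first.
  rewrite -(subrr p.[0]).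
  under eq_fun => m do rewrite expr0 divr1.
  by apply: cvgB => //; exact: cvg_horner_t.
apply: (cvg_near_eq (cvgD h (@cvg_horner_t p))); first by rewrite add0r.
by apply: nearW => m; rewrite fctE expr0 divr1 subrK.
Qed.

Lemma asym_horner n p : asym n (fun m => p.[t m]) p.
Proof.
apply/asymP; exists (cst 0); first exact: cvg_cst.
by apply: nearW => m; rewrite mulr0 addr0.
Qed.

Lemma asymD n f g p q : asym n f p -> asym n g q ->
  asym n (fun m => f m + g m) (p + q).
Proof.
rewrite /asym => fp gq; apply: (cvg_near_eq (cvgD fp gq)); first by rewrite addr0.
by apply: nearW => m /=; rewrite hornerD -mulrDl opprD addrACA.
Qed.

Lemma asymM n f g p q : asym n f p -> asym n g q ->
  asym n (fun m => f m * g m) (p * q).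
Proof.
move=> /asymP[e e0 fe] /asymP[d d0 gd]; apply/asymP.
exists (fun m => e m * q.[t m] + d m * p.[t m] + t m ^+ n * (e m * d m)).
  have tn : t m ^+ n @[m --> F] --> ((0 : R) ^+ n).
    by have := @cvg_horner_t 'X^n; rewrite hornerXn; under eq_fun => m do rewrite hornerXn.
  apply: (cvg_near_eq (cvgD (cvgD (cvgM e0 (@cvg_horner_t q))
    (cvgM d0 (@cvg_horner_t p))) (cvgM tn (cvgM e0 d0)))).
    by rewrite !mul0r mulr0 !addr0.
  exact: nearW.
by apply: filterS2 fe gd => m -> ->; rewrite hornerM; ring.
Qed.

Lemma asymZ n (c : R) f p : asym n f p -> asym n (fun m => c * f m) (c *: p).
Proof.
move=> fp; have := asymM (asym_horner n c%:P) fp; rewrite mul_polyC.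
by apply: asym_near; apply: nearW => m; rewrite hornerC.
Qed.

Lemma asymtM n f p : asym n f p -> asym n.+1 (fun m => t m * f m) ('X * p).
Proof.
move=> /asymP[e e0 fe]; apply/asymP; exists e => //.
by apply: filterS fe => m ->; rewrite hornerM hornerX exprS; ring.
Qed.

(** The constant term is the limit along [F], hence 0; a factor ['X] is then divided out and the
    order drops by one. *)
Lemma horner_t_o n p : p.[t m] / t m ^+ n @[m --> F] --> (0 : R) ->
  forall i, (i <= n)%N -> p`_i = 0.
Proof.
elim: n p => [|n IH] p h.
  have h1 : p.[t m] @[m --> F] --> (0 : R).
    by apply: cvg_trans h; apply: near_eq_cvg; near=> m; rewrite expr0 divr1.
  have p0 := cvg_unique _ h1 (@cvg_horner_t p).
  by case=> // _; rewrite -horner_coef0 -p0.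
have h1 : p.[t m] @[m --> F] --> (0 : R).
  have tn : t m ^+ n.+1 @[m --> F] --> (0 : R).
    have := @cvg_horner_t 'X^(n.+1); rewrite hornerXn expr0n/=.
    by under eq_fun => m do rewrite hornerXn.
  apply: (cvg_near_eq (cvgM h tn)); first by rewrite mul0r.
  by apply: filterS tN0 => m tm /=; rewrite divfK// expf_neq0.
have p0 := cvg_unique _ h1 (@cvg_horner_t p).
have [q pq] : exists q, p = 'X * q.
  have : root p 0 by rewrite /root -p0.
  by move=> /factor_theorem[q ->]; exists q; rewrite subr0 mulrC.
have hq : q.[t m] / t m ^+ n @[m --> F] --> (0 : R).
  apply: cvg_trans h; apply: near_eq_cvg.
  apply: filterS tN0 => m tm; rewrite pq hornerM hornerX exprS.
  by rewrite invfM mulrACA mulfV ?mul1r.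
by case=> [_|i ilt]; rewrite pq coefXM //=; exact: IH.
Unshelve. all: by end_near. Qed.

Lemma asym_uniq n f p q : asym n f p -> asym n f q ->
  forall i, (i <= n)%N -> p`_i = q`_i.
Proof.
move=> fp fq i ilt; apply/eqP; rewrite -subr_eq0 -coefB; apply/eqP.
apply: (@horner_t_o n) => //; move: fp fq; rewrite /asym => fp fq; apply: (cvg_near_eq (cvgB fq fp)); first by rewrite subr0.
apply: nearW => m; rewrite !fctE.
by rewrite -mulrBl hornerD hornerN; congr (_ / _); ring.
Qed.

Lemma asym_trunc n f p q : (forall i, (i <= n)%N -> p`_i = q`_i) ->
  asym n f p -> asym n f q.
Proof.
move=> pq /asymP[e e0 fe]; apply/asymP.
pose s : {poly R} := drop_poly n.+1 (p - q).
have ps : p - q = s * 'X^(n.+1).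
  rewrite -[LHS](poly_take_drop n.+1) -/s [take_poly _ _](_ : _ = 0) ?add0r//.
  by apply/polyP => i; rewrite coef_take_poly coef0 coefB; case: ifP => // /pq->; rewrite subrr.
exists (fun m => e m + t m * s.[t m]).
  apply: (cvg_near_eq (cvgD e0 (cvgM t0 (@cvg_horner_t s)))).
    by rewrite mul0r addr0.
  exact: nearW.
apply: filterS fe => m ->.
have -> : p.[t m] = q.[t m] + (p - q).[t m] by rewrite hornerD hornerN; ring.
by rewrite ps hornerM hornerXn exprS; ring.
Qed.

Lemma asym_le n k f p : (k <= n)%N -> asym n f p -> asym k f p.
Proof.
move=> kn /asymP[e e0 fe]; apply/asymP; exists (fun m => t m ^+ (n - k) * e m).
  apply: (cvg_near_eq (cvgM (@cvg_horner_t 'X^(n - k)) e0)).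
    by rewrite mulr0.
  by apply: nearW => m /=; rewrite hornerXn.
by apply: filterS fe => m ->; rewrite mulrA -exprD subnKC.
Qed.

Lemma asym_O n (C : R) f p :
  (\forall m \near F, `|f m - p.[t m]| <= C * `|t m| ^+ n.+1) -> asym n f p.
Proof.
move=> fp; apply: norm_cvg0.
have h : C * `|t m| @[m --> F] --> (0 : R).
  by rewrite -(mulr0 C) -(normr0 R); apply: cvgMr; apply: cvg_norm.
apply: (@squeeze_cvgr _ _ _ _ (cst 0) (fun m => C * `|t m|)) => //; last exact: cvg_cst.
apply: filterS2 tN0 fp => m tm h1; rewrite normr_ge0/= normrM normfV normrX.
rewrite ler_pdivrMr ?exprn_gt0 ?normr_gt0//.
by rewrite -mulrA -exprS.
Qed.

(** Division without inverting a series: [p] is a guessed quotient, tested only by its product with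
    [s] up to degree [n]. Then f g and p(t) g differ by o(t^n), and [g] stays away from 0. *)
Lemma asym_div n f g q (s : {poly R}) p : g @ F --> s`_0 -> s`_0 != 0 ->
  asym n (fun m => f m * g m) q -> asym n g s ->
  (forall i, (i <= n)%N -> q`_i = (p * s)`_i) -> asym n f p.
Proof.
move=> gs s0 fgq gq qps.
have gN0 : \forall m \near F, g m != 0.
  have : \forall y \near s`_0, y != 0 by apply: open_nbhs_nbhs; split => //; exact: open_neq.
  exact: gs.
have /asymP[e e0 fe] := asym_trunc qps fgq.
have /asymP[d d0 gd] := asymM (asym_horner n p) gq.
apply/asymP; exists (fun m => (e m - d m) / g m).
  apply: (cvg_near_eq (cvgM (cvgB e0 d0) (cvgV s0 gs))).
    by rewrite subrr mul0r.
  exact: nearW.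
near=> m.
have gm : g m != 0 by near: m.
apply: (mulIf gm).
have -> : f m * g m = (p * s).[t m] + t m ^+ n * e m by near: m.
have h : p.[t m] * g m = (p * s).[t m] + t m ^+ n * d m by near: m.
rewrite mulrDl h -!mulrA mulVf// mulr1; ring.
Unshelve. all: by end_near. Qed.

End AsymptoticExpansions.

(** * Orders t^0 and t^2 of the string equation, and Taylor polynomials of r_0 and r_2 *)

Section Genus.
Context (R : realType) (T : Type) (F : set_system T) {FF : ProperFilter F}.
Context (t : T -> R) (t0 : t @ F --> (0 : R)) (tN0 : \forall m \near F, t m != 0).
Variables (u x y : R).
Hypothesis u0 : 0 < u.

Lemma coefM_lt5 (p q : {poly R}) : ((p * q)`_0 = p`_0 * q`_0) *
  ((p * q)`_1 = p`_0 * q`_1 + p`_1 * q`_0) *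
  ((p * q)`_2 = p`_0 * q`_2 + p`_1 * q`_1 + p`_2 * q`_0) *
  ((p * q)`_3 = p`_0 * q`_3 + p`_1 * q`_2 + p`_2 * q`_1 + p`_3 * q`_0) *
  ((p * q)`_4 = p`_0 * q`_4 + p`_1 * q`_3 + p`_2 * q`_2 + p`_3 * q`_1 + p`_4 * q`_0).
Proof. by do !split; rewrite coefM !big_ord_recr big_ord0 /= add0r. Qed.

Lemma sextic_slope_neq0 (z : R) : 1 + 30 * u * z ^+ 2 != 0.
Proof. by have := mulr_ge0 (ltW u0) (sqr_ge0 z); move=> ?; rewrite gt_eqF//; lra. Qed.

Lemma asym_le_horner n (f : T -> R) (p q : {poly R}) :
  (\forall m \near F, `|f m - p.[t m]| <= `|q.[t m]|) ->
  (forall i, (i <= n)%N -> q`_i = 0) -> asym F t n f p.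
Proof.
move=> fpq q0.
have : asym F t n (fun m => q.[t m]) 0.
  apply: (asym_trunc t0 tN0) (asym_horner tN0 n q).
  by move=> i /q0 ->; rewrite coef0.
rewrite /asym => h.
apply: norm_cvg0.
apply: (@squeeze_cvgr _ _ _ _ (cst 0) (fun m => `|(q.[t m] - 0.[t m]) / t m ^+ n|)).
- apply: filterS fpq => m h1; rewrite normr_ge0/= !normrM ler_wpM2r//.
  by rewrite horner0 subr0.
- exact: cvg_cst.
- by rewrite -(normr0 R); apply: cvg_norm.
Qed.

(** [A], [B], [C] are the Taylor coefficients of z + 10 u z^3 at z = y; [genus0_taylor] is the
    inverse series. *)
Let A := 1 + 30 * u * y ^+ 2.
Let B := 30 * u * y.
Let C := 10 * u.

(* The Taylor polynomial of order 4, in the step [k t], of the solution of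
   [y + 10 u y^3 = x]. *)
Definition genus0_taylor (k : R) : {poly R} :=
  Poly [:: y; k / A; - B / A ^+ 3 * k ^+ 2;
    (2 * B ^+ 2 - A * C) / A ^+ 5 * k ^+ 3;
    (5 * A * B * C - 5 * B ^+ 3) / A ^+ 7 * k ^+ 4].

(** For u > 0 the map z + 10 u z^3 does not shrink distances, so the error of a trial polynomial is
    at most its residual in the equation. It remains to see that the residual [q] vanishes up to
    degree 4. *)
Lemma genus0_taylorP (k : R) (f : T -> R) : y + 10 * u * y ^+ 3 = x ->
  (\forall m \near F, f m + 10 * u * f m ^+ 3 = x + k * t m) ->
  asym F t 4 f (genus0_taylor k).
Proof.
move=> yx fx.
have A0 : A != 0 := sextic_slope_neq0 y.
pose p := genus0_taylor k.
pose q := p + (10 * u) *: (p * (p * p)) - x%:P - k *: 'X.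
apply: (@asym_le_horner _ _ _ q).
  apply: filterS fx => m fm.
  have -> : q.[t m] = (p.[t m] - f m) * (1 + 10 * u * (p.[t m] ^+ 2 + p.[t m] * f m + f m ^+ 2)).
    have xE : x = f m + 10 * u * f m ^+ 3 - k * t m by rewrite fm addrK.
    by rewrite /q !(hornerD, hornerN, hornerZ, hornerM, hornerC, hornerX) xE; ring.
  have Q0 : 0 <= u * (p.[t m] ^+ 2 + p.[t m] * f m + f m ^+ 2).
    by apply: mulr_ge0; [exact: ltW|nra].
  by rewrite distrC normrM ler_peMr// ger0_norm; lra.
have pE i : p`_i = [:: y; k / A; - B / A ^+ 3 * k ^+ 2;
    (2 * B ^+ 2 - A * C) / A ^+ 5 * k ^+ 3;
    (5 * A * B * C - 5 * B ^+ 3) / A ^+ 7 * k ^+ 4]`_i by rewrite coef_Poly.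
case=> [|[|[|[|[|//]]]]] _; rewrite /q !coefB coefD !coefZ coefC coefX !coefM_lt5 !pE /= -?yx.
- by ring.
- by rewrite /A; field; exact: sextic_slope_neq0.
- by rewrite /B /A; field; exact: sextic_slope_neq0.
- by rewrite /B /C /A; field; exact: sextic_slope_neq0.
- by rewrite /B /C /A; field; exact: sextic_slope_neq0.
Qed.

Section String.
Variable a : nat -> T -> R.
Hypothesis string : \forall m \near F,
  x = a 2%N m * (1 + u * string_sum (a 0%N m) (a 1%N m) (a 2%N m) (a 3%N m) (a 4%N m)).

(** Both sides are expansions of the same constant function, so their coefficients agree. *)
Lemma asym_string n (p : nat -> {poly R}) :
  (forall i, (i < 5)%N -> asym F t n (a i) (p i)) ->
  forall i, (i <= n)%N ->
  (p 2%N * (1 + u *: (p 3%N * (p 2%N + p 3%N + p 4%N) + (p 1%N + p 2%N + p 3%N) * (p 2%N + p 1%N) + p 1%N * p 0%N)))`_i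
    = (x%:P)`_i.
Proof.
move=> ap i ilt; apply: (asym_uniq t0 tN0 (n := n) (f := fun=> x)) => //; last first.
  by apply: asym_near (asym_horner tN0 n x%:P); apply: nearW => m; rewrite hornerC.
have one : asym F t n (fun=> 1) 1.
  by apply: asym_near (asym_horner tN0 n 1); apply: nearW => m; rewrite hornerC.
have [a0 a1 a2 a3 a4] : [/\ asym F t n (a 0%N) (p 0%N), asym F t n (a 1%N) (p 1%N),
   asym F t n (a 2%N) (p 2%N), asym F t n (a 3%N) (p 3%N) & asym F t n (a 4%N) (p 4%N)].
  by split; exact: ap.
have D f g pf pg := @asymD _ _ F FF t n f g pf pg.
have M f g pf pg := @asymM _ _ F FF t t0 tN0 n f g pf pg.
apply: asym_near (M _ _ _ _ a2 (D _ _ _ _ one (asymZ t0 tN0 u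
  (D _ _ _ _ (D _ _ _ _ (M _ _ _ _ a3 (D _ _ _ _ (D _ _ _ _ a2 a3) a4))
    (M _ _ _ _ (D _ _ _ _ (D _ _ _ _ a1 a2) a3) (D _ _ _ _ a2 a1)))
    (M _ _ _ _ a1 a0))))).
by apply: filterS string => m <-.
Qed.

Lemma genus0_string : (forall i, (i < 5)%N -> a i @ F --> y) ->
  y + 10 * u * y ^+ 3 = x.
Proof.
move=> ay.
have ap i : (i < 5)%N -> asym F t 0 (a i) y%:P.
  by move=> /ay h; apply/asym0P; rewrite ?coefC.
have := asym_string ap (leqnn 0).
rewrite !(coefM_lt5, coefD, coefZ, coefC)/= => <-; ring.
Qed.

Lemma genus1_string (r : R) : y + 10 * u * y ^+ 3 = x ->
  (forall i, (i < 5)%N -> asym F t 2 (a i) (genus0_taylor (i%:R - 2) + r *: 'X^2)) ->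
  r * A ^+ 4 = - (5 * u * y * (1 - 90 * u * y ^+ 2)).
Proof.
move=> yx ap; have := asym_string ap (leqnn 2).
rewrite !(coefM_lt5, coefD, coefZ, coefC, coefXn, coef_Poly)/= ; set E := (X in X = _) => h.
(* The coefficient of t^2 is [r * A] plus terms with denominators up to A^3; times A^3 it is the
   difference of the two sides of the goal. *)
apply/eqP; rewrite -subr_eq0 -(mulr0 (A ^+ 3)) -h; apply/eqP.
rewrite /E /B /C /A; field.
exact: sextic_slope_neq0.
Qed.

(** n0 / A^4 is r_2 as a function of y, and [n1], [n2] are the first two derivatives of [n0] in y.
    As dy/dx = 1/A and dA/dy = 2 B, the x-derivative of r_2 is m0 / A^6; [m1] is the derivative of
    [m0] in y and enters the second one, (m1 A - 12 B m0) / A^8. *)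
Let n0 : R := - (5 * u * y * (1 - 90 * u * y ^+ 2)).
Let n1 : R := - (5 * u) + 1350 * u ^+ 2 * y ^+ 2.
Let n2 : R := 2700 * u ^+ 2 * y.
Let m0 : R := n1 * A - 8 * B * n0.
Let m1 : R := n2 * A - 6 * B * n1 - 240 * u * n0.

Definition genus1_taylor (k : R) : {poly R} :=
  Poly [:: n0 / A ^+ 4; m0 / A ^+ 6 * k; (m1 * A - 12 * B * m0) / (2 * A ^+ 8) * k ^+ 2].

Lemma genus1_taylorP (k : R) (f g : T -> R) : y + 10 * u * y ^+ 3 = x ->
  (\forall m \near F, f m + 10 * u * f m ^+ 3 = x + k * t m) ->
  (\forall m \near F, g m * (1 + 30 * u * f m ^+ 2) ^+ 4
     = - (5 * u * f m * (1 - 90 * u * f m ^+ 2))) ->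
  asym F t 2 g (genus1_taylor k).
Proof.
move=> yx fx gf.
have fp : asym F t 2 f (genus0_taylor k).
  by apply: (asym_le t0 tN0) (genus0_taylorP yx fx).
have D f g pf pg := @asymD _ _ F FF t 2 f g pf pg.
have M f g pf pg := @asymM _ _ F FF t t0 tN0 2 f g pf pg.
have Z c f pf := @asymZ _ _ F FF t t0 tN0 2 c f pf.
have one : asym F t 2 (fun=> 1) 1.
  by apply: asym_near (asym_horner tN0 2 1); apply: nearW => m; rewrite hornerC.
set p := genus0_taylor k in fp.
have A0 : A != 0 := sextic_slope_neq0 y.
have ff : asym F t 2 (fun m => f m * f m) (p * p) := M _ _ _ _ fp fp.
have dp : asym F t 2 (fun m => 1 + 30 * u * (f m * f m)) (1 + (30 * u) *: (p * p)) := D _ _ _ _ one (Z (30 * u) _ _ ff).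
have dp2 := M _ _ _ _ dp dp.
have dp4 := M _ _ _ _ dp2 dp2.
have np1 : asym F t 2 (fun m => 1 + (- (90 * u)) * (f m * f m)) (1 + (- (90 * u)) *: (p * p)) :=
  D _ _ _ _ one (Z _ _ _ ff).
have np := Z (- (5 * u)) _ _ (M _ _ _ _ fp np1).
(* The equation gives the product of [g] with a factor that tends to A^4, which is nonzero. *)
apply: (asym_div t0 tN0 _ _ (asym_near _ np) dp4).
- by apply/(asym0P t0); apply: (asym_le t0 tN0) dp4.
- rewrite !(coefM_lt5, coefD, coefZ, coefC, coef_Poly)/=.
  by rewrite -expr2 -/A !mulf_neq0.
- by apply: filterS gf => m gm; rewrite -!expr2 -exprM gm; ring.
case=> [|[|[|//]]] _; rewrite !(coefM_lt5, coefD, coefZ, coefC, coef_Poly)/=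
  /m1 /m0 /n2 /n1 /n0 /B /A; field; exact: sextic_slope_neq0.
Qed.

End String.
End Genus.

(** * Order t^4 of the string equation *)

Section GenusTwo.
Context (R : realType) (T : Type) (F : set_system T) {FF : ProperFilter F}.
Context (t : T -> R) (t0 : t @ F --> (0 : R)) (tN0 : \forall m \near F, t m != 0).
Variables (u x y : R) (u0 : 0 < u) (a : nat -> T -> R).
Hypothesis string : \forall m \near F,
  x = a 2%N m * (1 + u * string_sum (a 0%N m) (a 1%N m) (a 2%N m) (a 3%N m) (a 4%N m)).

(** Here the [c]'s come from r_0, the [s]'s from t^2 r_2, and [r] is r_4, at the shift i - 2.
    Keeping them symbolic separates the expansion of the string equation from the simplification of
    their fractions. *)
Lemma string_coef4 (p : nat -> {poly R}) (c0 c1 c2 s2 c3 s3 c4 s4 r : R) :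
  (forall i, [/\ (p i)`_0 = c0, (p i)`_1 = c1 * (i%:R - 2),
    (p i)`_2 = c2 * (i%:R - 2) ^+ 2 + s2,
    (p i)`_3 = c3 * (i%:R - 2) ^+ 3 + s3 * (i%:R - 2) &
    (p i)`_4 = c4 * (i%:R - 2) ^+ 4 + s4 * (i%:R - 2) ^+ 2 + r]) ->
  (p 2%N * (1 + u *: (p 3%N * (p 2%N + p 3%N + p 4%N)
     + (p 1%N + p 2%N + p 3%N) * (p 2%N + p 1%N) + p 1%N * p 0%N)))`_4 =
  r * (1 + 30 * u * c0 ^+ 2) + u * (44 * c4 * c0 ^+ 2 + 20 * s4 * c0 ^+ 2
    + 22 * c1 * c3 * c0 + 10 * c1 * s3 * c0 + 40 * c2 * s2 * c0 + 11 * c2 ^+ 2 * c0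
    + 30 * s2 ^+ 2 * c0 + 5 * c1 ^+ 2 * s2).
Proof.
move=> pE.
have e0 i : (p i)`_0 = c0 by have [] := pE i.
have e1 i : (p i)`_1 = c1 * (i%:R - 2) by have [] := pE i.
have e2 i : (p i)`_2 = c2 * (i%:R - 2) ^+ 2 + s2 by have [] := pE i.
have e3 i : (p i)`_3 = c3 * (i%:R - 2) ^+ 3 + s3 * (i%:R - 2) by have [] := pE i.
have e4 i : (p i)`_4 = c4 * (i%:R - 2) ^+ 4 + s4 * (i%:R - 2) ^+ 2 + r by have [] := pE i.
clear pE.
rewrite coefM_lt5 !coefD !coefZ !coefD !coefM_lt5 !coefD !coefC.
rewrite !(e0, e1, e2, e3, e4)/=.
ring.
Qed.

Lemma genus2_string (r : R) : y != 0 -> y + 10 * u * y ^+ 3 = x ->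
  (forall i, (i < 5)%N -> asym F t 4 (a i)
     (genus0_taylor u y (i%:R - 2) + 'X^2 * genus1_taylor u y (i%:R - 2) + r *: 'X^4)) ->
  let v := 10 * u * y ^+ 2 in
  r * (1 + 30 * u * y ^+ 2) ^+ 9 = 5 * u ^+ 2 * y * (59 * (1 + v) ^+ 3
    - (4 * 10 ^+ 3 + 11) * v * (1 + v) ^+ 2
    + (27 * 10 ^+ 3 + 528) * v ^+ 2 * (1 + v) - (34 * 10 ^+ 3 + 268) * v ^+ 3).
Proof.
move=> y0 yx ap v; have A0 := sextic_slope_neq0 u0 y.
pose A := 1 + 30 * u * y ^+ 2; pose B := 30 * u * y; pose C := 10 * u.
pose n0 := - (5 * u * y * (1 - 90 * u * y ^+ 2)).
pose n1 := - (5 * u) + 1350 * u ^+ 2 * y ^+ 2.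
pose m0 := n1 * A - 8 * B * n0.
pose m1 := 2700 * u ^+ 2 * y * A - 6 * B * n1 - 240 * u * n0.
pose p (i : nat) : {poly R} :=
  genus0_taylor u y (i%:R - 2) + 'X^2 * genus1_taylor u y (i%:R - 2) + r *: 'X^4.
have pE (i : nat) : [/\ (p i)`_0 = y, (p i)`_1 = A^-1 * (i%:R - 2),
    (p i)`_2 = - B / A ^+ 3 * (i%:R - 2) ^+ 2 + n0 / A ^+ 4,
    (p i)`_3 = (2 * B ^+ 2 - A * C) / A ^+ 5 * (i%:R - 2) ^+ 3
      + m0 / A ^+ 6 * (i%:R - 2) &
    (p i)`_4 = (5 * A * B * C - 5 * B ^+ 3) / A ^+ 7 * (i%:R - 2) ^+ 4
      + (m1 * A - 12 * B * m0) / (2 * A ^+ 8) * (i%:R - 2) ^+ 2 + r].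
  rewrite /p; split; rewrite !coefD coefXnM coefZ coefXn !coef_Poly/=
    ?mulr0 ?mulr1 ?addr0 //.
  by rewrite mulrC.
have := asym_string (FF := FF) t0 tN0 string (p := p) ap (leqnn 4).
rewrite (string_coef4 pE) /m1 /m0 /n1 /n0 /C /B /A.
rewrite coefC/=.
(* Trading u for W = 1 + 30 u y^2 leaves only powers of W and y in the denominators. *)
have : u = ((1 + 30 * u * y ^+ 2) - 1) / (30 * y ^+ 2) by field.
rewrite /v; move: (1 + 30 * u * y ^+ 2) A0 => W W0 uE; rewrite {}uE.
set E := (X in X = _) => h.
(* The coefficient of t^4 contains [r] as r W, so the factor W^8 produces the r W^9 of the goal. *)
apply/eqP; rewrite -subr_eq0 -(mulr0 (W ^+ 8)) -h; apply/eqP.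
rewrite /E; field.
by rewrite W0 y0.
Qed.
End GenusTwo.

(** * Absolutely convergent double series, summed by squares and by columns *)

Section DoubleSeries.
Context (R : realType).
Implicit Types (a b : nat -> nat -> R) (F G : nat -> R).

Lemma sum_tail_le F G m n : (forall i, `|F i| <= G i) -> (m <= n)%N ->
  `|\sum_(i < n) F i - \sum_(i < m) F i| <= \sum_(i < n) G i - \sum_(i < m) G i.
Proof.
move=> FG; elim: n => [|n IH].
  by rewrite leqn0 => /eqP ->; rewrite !big_ord0 subrr normr0.
rewrite leq_eqVlt => /predU1P[->|]; first by rewrite !subrr normr0.
rewrite ltnS => /IH h; rewrite !big_ord_recr/= ![_ + _ - _]addrAC.
exact: le_trans (ler_normD _ _) (lerD h (FG n)).
Qed.

Definition rect_sum a (m n : nat) : R := \sum_(i < m) \sum_(j < n) a i j.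

(** The part of the rectangle outside the small square lies in the large square, where [b]
    dominates. *)
Lemma rect_square_le a b m n : (forall i j, `|a i j| <= b i j) -> (m <= n)%N ->
  `|rect_sum a n m - square_sum a m| <= square_sum b n - square_sum b m.
Proof.
move=> ab mn; have b0 i j : 0 <= b i j by exact: le_trans (ab i j).
apply: (@le_trans _ _ (rect_sum b n m - square_sum b m)).
  apply: (sum_tail_le (F := fun i => \sum_(j < m) a i j)
    (G := fun i => \sum_(j < m) b i j)) => // i.
  by apply: le_trans (ler_norm_sum _ _ _) _; apply: ler_sum.
rewrite lerD2r; apply: ler_sum => i _.
rewrite -subr_ge0; apply: le_trans (sum_tail_le (F := b i) (G := b i) _ mn) => //.
by move=> j; rewrite ger0_norm.
Qed.

Lemma square_sum_tail_le a b m n : (forall i j, `|a i j| <= b i j) -> (m <= n)%N ->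
  `|square_sum a n - square_sum a m| <= square_sum b n - square_sum b m.
Proof.
move=> ab mn.
have -> : square_sum b n - square_sum b m =
  (square_sum b n - rect_sum b n m) + (rect_sum b n m - square_sum b m) by ring.
have -> : square_sum a n - square_sum a m =
  (square_sum a n - rect_sum a n m) + (rect_sum a n m - square_sum a m) by ring.
apply: le_trans (ler_normD _ _) (lerD _ _).
  rewrite /square_sum /rect_sum -!sumrB.
  apply: le_trans (ler_norm_sum _ _ _) (ler_sum _ _) => i _.
  exact: sum_tail_le.
apply: (sum_tail_le (F := fun i => \sum_(j < m) a i j)
    (G := fun i => \sum_(j < m) b i j)) => // i.
by apply: le_trans (ler_norm_sum _ _ _) _; apply: ler_sum.
Qed.

Lemma square_sum_nondecreasing b : (forall i j, 0 <= b i j) ->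
  nondecreasing_seq (square_sum b).
Proof.
move=> b0 m n mn; rewrite -subr_ge0.
apply: le_trans (square_sum_tail_le (a := b) (b := b) _ mn) => // i j.
by rewrite ger0_norm.
Qed.

Lemma square_sum_le_lim b m : (forall i j, 0 <= b i j) -> cvgn (square_sum b) ->
  square_sum b m <= limn (square_sum b).
Proof.
move=> b0 cb; apply: nondecreasing_cvgn_le => //.
exact: square_sum_nondecreasing.
Qed.

Lemma square_sum_cvg_uniform a b (l : R) m : (forall i j, `|a i j| <= b i j) ->
  cvgn (square_sum b) -> square_sum a @ \oo --> l ->
  `|l - square_sum a m| <= limn (square_sum b) - square_sum b m.
Proof.
move=> ab cb al; have b0 i j : 0 <= b i j by exact: le_trans (ab i j).
have h : `|square_sum a n - square_sum a m| @[n --> \oo] --> `|l - square_sum a m|.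
  by apply: cvg_norm; apply: cvgB => //; exact: cvg_cst.
rewrite -(cvg_lim _ h)//; apply: limr_le; first by apply/cvg_ex; exists (`|l - square_sum a m|).
exists m => // n /= mn; apply: le_trans (square_sum_tail_le ab mn) _.
by rewrite lerD2r; exact: square_sum_le_lim.
Qed.

Lemma cvg_ord_sum (s : nat -> nat -> R) (l : nat -> R) m :
  (forall j, s ^~ j @ \oo --> l j) ->
  \sum_(j < m) s n j @[n --> \oo] --> \sum_(j < m) l j.
Proof.
move=> sl; elim: m => [|m IH].
  rewrite big_ord0; under eq_fun => n do rewrite big_ord0.
  exact: cvg_cst.
rewrite big_ord_recr/=; under eq_fun => n do rewrite big_ord_recr/=.
by apply: cvgD => //; exact: sl.
Qed.

(** The distance from a rectangle to the square of the same width is at most a tail of [b], whatever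
    the height. The height can therefore go to infinity first, and the width afterwards. *)
Lemma square_sum_columns a b (l : R) (s : nat -> R) : (forall i j, `|a i j| <= b i j) ->
  cvgn (square_sum b) -> square_sum a @ \oo --> l ->
  (forall j, \sum_(i < n) a i j @[n --> \oo] --> s j) ->
  \sum_(j < m) s j @[m --> \oo] --> l.
Proof.
move=> ab cb al cs; have b0 i j : 0 <= b i j by exact: le_trans (ab i j).
have h m : `|\sum_(j < m) s j - square_sum a m| <= limn (square_sum b) - square_sum b m.
  have h1 : `|rect_sum a n m - square_sum a m| @[n --> \oo] -->
      `|\sum_(j < m) s j - square_sum a m|.
    apply: cvg_norm; apply: cvgB; last exact: cvg_cst.
    rewrite /rect_sum; under eq_fun => n do rewrite exchange_big/=.
    exact: (@cvg_ord_sum (fun n j => \sum_(i < n) a i j)).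
  rewrite -(cvg_lim _ h1)//; apply: limr_le.
    by apply/cvg_ex; exists (`|\sum_(j < m) s j - square_sum a m|).
  exists m => // n /= mn; apply: le_trans (rect_square_le ab mn) _.
  by rewrite lerD2r; exact: square_sum_le_lim.
have h0 : (\sum_(j < m) s j - square_sum a m) @[m --> \oo] --> (0 : R).
  apply: norm_cvg0.
  apply: (@squeeze_cvgr _ _ _ _ (cst 0) (fun m => limn (square_sum b) - square_sum b m)).
  - by apply: nearW => m; rewrite normr_ge0 h.
  - exact: cvg_cst.
  - by rewrite -(subrr (limn (square_sum b))); apply: cvgB => //; exact: cvg_cst.
apply: (cvg_near_eq (cvgD h0 al)); first by rewrite add0r.
by apply: nearW => m; rewrite fctE subrK.
Qed.

Lemma column_cvg a b j : (forall i j, `|a i j| <= b i j) ->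
  cvgn (square_sum b) -> cvgn (fun n => \sum_(i < n) a i j).
Proof.
move=> ab cb; have b0 i k : 0 <= b i k by exact: le_trans (ab i k).
suff : cvgn (series (fun i => a i j)).
  by rewrite /series/=; under eq_fun => n do rewrite big_mkord.
apply: normed_cvg; apply: nondecreasing_is_cvgn.
  apply/nondecreasing_seqP => n; rewrite /series [leRHS]big_nat_recr//=.
  by rewrite lerDl.
exists (limn (square_sum b)) => _ [n _ <-]; rewrite /series [leLHS]big_mkord.
apply: (@le_trans _ _ (square_sum b (maxn n j.+1))); last exact: square_sum_le_lim.
have le1 i : `|a i j| <= \sum_(k < maxn n j.+1) b i k.
  have jl : (j < maxn n j.+1)%N by rewrite leq_maxr.
  rewrite (bigD1 (Ordinal jl))//=; apply: le_trans (ab i j) _.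
  by rewrite lerDl sumr_ge0.
apply: (@le_trans _ _ (\sum_(i < n) \sum_(k < maxn n j.+1) b i k)).
  by apply: ler_sum => i _; exact: le1.
rewrite -subr_ge0; apply: le_trans (sum_tail_le (F := fun=> 0)
  (G := fun i => \sum_(k < maxn n j.+1) b i k) _ (leq_maxl _ _)) => // i.
by rewrite normr0 sumr_ge0.
Qed.

End DoubleSeries.

(** * A convergent power series is an asymptotic expansion at 0+ *)

Section PowerSeries.
Context (R : realType).

Lemma sum_geometric_le2 (q : R) m : 0 <= q -> q <= 1 / 2 -> \sum_(k < m) q ^+ k <= 2.
Proof.
move=> q0 q2.
have : \sum_(k < m) q ^+ k <= 2 - 2 * q ^+ m.
  elim: m => [|m IH]; first by rewrite big_ord0 expr0; lra.
  rewrite big_ord_recr/=; apply: le_trans (lerD IH (lexx _)) _.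
  by have := exprn_ge0 m q0; rewrite exprS; nra.
by have := exprn_ge0 m q0; lra.
Qed.

(** Convergence at u0 = rho / 2 bounds a_j u0^j by some M. For u < u0 / 2 the tail is dominated by a
    geometric series of ratio at most 1/2, hence by 2 M (u / u0)^(n+1). *)
Lemma power_series_asym (a : nat -> R) (g : R -> R) (rho : R) n : 0 < rho ->
  (forall u : R, 0 < u < rho -> \sum_(j < m) a j * u ^+ j @[m --> \oo] --> g u) ->
  asym (0 : R)^'+ id n g (\poly_(j < n.+1) a j).
Proof.
move=> rho0 ag.
pose u0 := rho / 2.
have u0r : 0 < u0 < rho by rewrite /u0; lra.
have u00 : 0 < u0 by case/andP: u0r.
have [M M0 aM] : exists2 M : R, 0 < M & forall j, `|a j| * u0 ^+ j <= M.
  have : cvgn (series (fun j => a j * u0 ^+ j)).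
    rewrite /series/=; under eq_fun => m do rewrite big_mkord.
    by apply/cvg_ex; exists (g u0); exact: ag.
  move/cvg_series_cvg_0 => h.
  have /cvg_seq_bounded [M [_ hM]] : cvgn (fun j => a j * u0 ^+ j) by apply/cvg_ex; exists 0.
  exists (`|M| + 1); first by rewrite ltr_pwDr.
  move=> j; have := hM (`|M| + 1) _ j I; rewrite /= normrM normrX (gtr0_norm u00); apply.
  by rewrite (le_lt_trans (ler_norm M))// ltrDl.
apply: (@asym_O _ _ _ _ _ _ _ _ (2 * M / u0 ^+ n.+1)).
- exact: cvg_at_right_filter.
- by near=> u; rewrite gt_eqF.
near=> u.
have u_gt0 : 0 < u by [].
have u_lt : u < u0 / 2 by near: u; apply: nbhs_right_lt; rewrite divr_gt0.
have ur : 0 < u < rho by rewrite u_gt0/= (lt_trans u_lt)//; move: u0r => /andP[]; rewrite /u0; lra.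
rewrite horner_poly (gtr0_norm u_gt0).
have h1 : `|\sum_(j < m) a j * u ^+ j - \sum_(j < n.+1) a j * u ^+ j| @[m --> \oo]
    --> `|g u - \sum_(j < n.+1) a j * u ^+ j|.
  by apply: cvg_norm; apply: cvgB; [exact: ag|exact: cvg_cst].
rewrite -(cvg_lim _ h1)//; apply: limr_le; first by apply/cvg_ex; eexists; exact: h1.
exists n.+1 => // m /= nm.
pose q : R := u / u0.
have q0 : 0 <= q by rewrite divr_ge0// ltW.
have q2 : q <= 1 / 2 by rewrite ler_pdivrMr//; lra.
have F j : `|a j * u ^+ j| <= M * q ^+ j.
  rewrite normrM normrX (gtr0_norm u_gt0) /q expr_div_n mulrA ler_pdivlMr ?exprn_gt0//.
  by rewrite mulrAC ler_wpM2r// exprn_ge0// ltW.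
apply: le_trans (sum_tail_le (F := fun j => a j * u ^+ j) (G := fun j => M * q ^+ j) F nm) _.
rewrite -(subnKC nm) big_split_ord/= addrAC subrr add0r.
under eq_bigr => i _ do rewrite exprD mulrA.
rewrite -mulr_sumr.
have -> : 2 * M / u0 ^+ n.+1 * u ^+ n.+1 = M * q ^+ n.+1 * 2.
  by rewrite /q (expr_div_n u u0); ring.
by rewrite ler_wpM2l ?sum_geometric_le2// mulr_ge0 ?exprn_ge0// ltW.
Unshelve. all: by end_near. Qed.

End PowerSeries.

(** * Analytic functions of two variables: power series in u, continuity in x *)

Section Analytic.
Context (R : realType) (f : R -> R -> R) (x0 u0 : R).
Context (c : nat -> nat -> R) (rho : R).
Hypothesis rho0 : 0 < rho.
Hypothesis fc : forall x u, `|x - x0| < rho -> `|u - u0| < rho ->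
  let t i j := c i j * (x - x0) ^+ i * (u - u0) ^+ j in
  cvgn (square_sum (fun i j => `|t i j|)) /\ square_sum t @ \oo --> f x u.

Definition column_series (x : R) (j : nat) : R :=
  limn (fun n => \sum_(i < n) c i j * (x - x0) ^+ i).

Lemma analytic_columns x u : `|x - x0| < rho -> `|u - u0| < rho ->
  \sum_(j < m) column_series x j * (u - u0) ^+ j @[m --> \oo] --> f x u.
Proof.
move=> xr ur; have [cb al] := fc xr ur.
apply: (square_sum_columns (s := fun j => column_series x j * (u - u0) ^+ j) _ cb al) => // j.
under eq_fun => n do rewrite -mulr_suml.
apply: cvgMl; rewrite /column_series.
(* Convergence of the column is tested at a point other than u0: at u = u0 the factor (u - u0)^j
   would hide it for j > 0. *)
pose v := u0 + rho / 2.
have v0 : v - u0 = rho / 2 by rewrite /v; ring.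
have vr : `|v - u0| < rho by rewrite v0 gtr0_norm ?divr_gt0// ltr_pdivrMr// ltr_pMr// ltr1n.
have [cb' _] := fc xr vr.
have := column_cvg (j := j) (fun _ _ => lexx _) cb'.
under eq_fun => n do rewrite -mulr_suml v0.
have w0 : (rho / 2) ^+ j != 0 by rewrite expf_neq0// gt_eqF// divr_gt0.
move=> h; apply/cvg_ex.
exists (limn (fun n => (\sum_(i < n) c i j * (x - x0) ^+ i) * (rho / 2) ^+ j) / (rho / 2) ^+ j).
apply: (cvg_near_eq (cvgM h (cvg_cst ((rho / 2) ^+ j)^-1))) => //.
by apply: nearW => n /=; rewrite mulfK.
Qed.

(** The square sums are polynomials in x. The absolute series at x0 + r', with r' halfway between |x
    - x0| and rho, dominates all those with |z - x0| < r', so convergence is uniform near x. *)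
Lemma analytic_continuous x u : `|x - x0| < rho -> `|u - u0| < rho ->
  {for x, continuous (f ^~ u)}.
Proof.
move=> xr ur.
pose r' := (`|x - x0| + rho) / 2.
have r'0 : 0 <= r' by rewrite /r' divr_ge0// addr_ge0// ltW.
have xr' : `|x - x0| < r' by rewrite /r'; lra.
have r'r : r' < rho by rewrite /r'; lra.
have zr : `|(x0 + r') - x0| < rho by rewrite addrAC subrr add0r ger0_norm.
have [cb _] := fc zr ur.
set b := (X in square_sum X) in cb.
have S_cont m : continuous (fun z => square_sum (fun i j => c i j * (z - x0) ^+ i * (u - u0) ^+ j) m).
  move=> z.
  pose p := \sum_(i < m) \sum_(j < m) (c i j * (u - u0) ^+ j) *: ('X - x0%:P) ^+ i.
  have -> : (fun z => square_sum (fun i j => c i j * (z - x0) ^+ i * (u - u0) ^+ j) m) = horner p.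
    apply/funext => s; rewrite /p horner_sum; apply: eq_bigr => i _.
    rewrite horner_sum; apply: eq_bigr => j _.
    by rewrite hornerZ horner_exp hornerXsubC mulrAC.
  exact: continuous_horner.
apply/cvgrPdist_lt => e e0.
have e3 : 0 < e / 3 by rewrite divr_gt0.
have [m hm] : exists m, limn (square_sum b) - square_sum b m < e / 3.
  have /cvgrPdist_lt /(_ _ e3) [m _ hm] := cb.
  exists m; apply: le_lt_trans (hm m (leqnn m)); exact: ler_norm.
have unif z : `|z - x0| < r' -> `|f z u - square_sum (fun i j => c i j * (z - x0) ^+ i * (u - u0) ^+ j) m| < e / 3.
  move=> zr'; have [_ al] := fc (lt_trans zr' r'r) ur.
  apply: le_lt_trans hm; apply: square_sum_cvg_uniform => // i j.
  rewrite /b addrAC subrr add0r !normrM ler_wpM2r// ler_wpM2l//.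
  by rewrite !normrX lerXn2r ?nnegrE// (ger0_norm r'0) ltW.
near=> z.
have zr' : `|z - x0| < r'.
  near: z; have : `|z - x0| @[z --> x] --> `|x - x0|.
    by apply: cvg_norm; apply: cvgB; [exact: cvg_id|exact: cvg_cst].
  by move=> /cvgr_lt; apply.
have hS : `|square_sum (fun i j => c i j * (x - x0) ^+ i * (u - u0) ^+ j) m -
   square_sum (fun i j => c i j * (z - x0) ^+ i * (u - u0) ^+ j) m| < e / 3.
  by near: z; have /cvgrPdist_lt := S_cont m x; apply.
have h1 := unif x xr'; have h2 := unif z zr'.
move: h1 h2 hS; rewrite !ltr_norml => /andP[? ?] /andP[? ?] /andP[? ?].
apply/andP; split; lra.
Unshelve. all: by end_near. Qed.
End Analytic.

(** * Binomial identities behind the series T = w (1 + T)^3, and terminating 2F1 at -2 *)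

Section TreeBinomials.
Context (R : realType).
Implicit Types (a j k m n : nat).

(** The guard gives 0 for m > j, where truncated subtraction would leave the binomial coefficient
    1. *)
Definition tree_bin n j m : R := if (m <= j)%N then 'C(n, j - m)%:R else 0.

Lemma tree_binS n j m : tree_bin n.+1 j m = tree_bin n j m + tree_bin n j m.+1.
Proof.
rewrite /tree_bin; case: (ltngtP m j) => [mj|mj|->]; last by rewrite subnn !bin0 addr0.
  by rewrite -(subnSK mj) binS natrD.
by rewrite addr0.
Qed.

Lemma tree_bin_shift n j m : tree_bin n j.+1 m.+1 = tree_bin n j m.
Proof. by rewrite /tree_bin ltnS subSS. Qed.

(** Pascal's rule three times, the counterpart of T^(m+1) = w T^m (1 + T)^3. *)
Lemma tree_bin_rec j m : tree_bin (3 * j.+1) j.+1 m.+1 =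
  tree_bin (3 * j) j m + 3 * tree_bin (3 * j) j m.+1
  + 3 * tree_bin (3 * j) j m.+2 + tree_bin (3 * j) j m.+3.
Proof. by rewrite tree_bin_shift mulnS !addSn add0n !tree_binS; ring. Qed.

(** For m = 0 the counterpart is (1 + T) / (1 - 2 T) = 1 + 3 w (1 + T)^3 / (1 - 2 T); on binomials
    it is the absorption identity. *)
Lemma tree_bin_rec0 j : tree_bin (3 * j.+1) j.+1 0 =
  3 * (tree_bin (3 * j) j 0 + 2 * tree_bin (3 * j) j 1 + tree_bin (3 * j) j 2).
Proof.
have -> : tree_bin (3 * j) j 0 + 2 * tree_bin (3 * j) j 1 + tree_bin (3 * j) j 2 =
  tree_bin (3 * j).+2 j 0 by rewrite !tree_binS; ring.
have := mul_bin_diag (3 * j).+3 j; rewrite /tree_bin /= !subn0 mulnS !addSn add0n.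
move/(congr1 (fun n => n%:R : R)); rewrite !natrM => h.
have j0 : (j.+1%:R : R) != 0 by rewrite pnatr_eq0.
apply: (mulfI j0); rewrite -h (_ : (3 * j).+3 = (3 * j.+1)%N) ?natrM; [ring|lia].
Qed.

(** Coefficient of w^j in 1 + T, written as (1 + T) (1 - 2 T) / (1 - 2 T). *)
Lemma tree_bin_fact j : tree_bin (3 * j) j 0 - 2 * tree_bin (3 * j) j 1 =
  (3 * j)`!%:R / (j`!%:R * (2 * j + 1)`!%:R).
Proof.
rewrite /tree_bin /= subn0; case: j => [|j]; first by rewrite !muln0 add0n mulr0 subr0 bin0 factS !fact0 muln1 mulr1 divr1.
rewrite /= subn1 /=.
have e1 := @bin_fact (3 * j.+1) j.+1 ltac:(lia).
have e2 := @bin_fact (3 * j.+1) j ltac:(lia).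
rewrite (_ : (3 * j.+1 - j.+1)%N = (2 * j.+1)%N) in e1; last by lia.
rewrite (_ : (3 * j.+1 - j)%N = (2 * j.+1 + 1)%N) in e2; last by lia.
move/(congr1 (fun n => n%:R : R)): e1; rewrite natrM natrM => e1.
move/(congr1 (fun n => n%:R : R)): e2; rewrite natrM natrM => e2.
have f0 n : (n`!%:R : R) != 0 by rewrite pnatr_eq0 -lt0n fact_gt0.
apply: (mulIf (mulf_neq0 (f0 j.+1) (f0 (2 * j.+1 + 1)%N))).
rewrite [RHS]divfK ?mulf_neq0// mulrBl.
rewrite [X in _ - X = _](_ : _ = 2 * j.+1%:R * (3 * j.+1)`!%:R); last first.
  by rewrite -e2 (factS j) (natrM _ j.+1); ring.
rewrite [X in X - _ = _](_ : _ = (2 * j.+1 + 1)%:R * (3 * j.+1)`!%:R); last first.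
  by rewrite -e1 addn1 (factS (2 * j.+1)) (natrM _ (2 * j.+1).+1); ring.
rewrite natrD natrM; ring.
Qed.

(** Coefficient of w^j in T^m (1 + T) / (1 - 2 T)^(a+1), from the binomial series of (1 - 2 T)^(-a);
    terms with k > j vanish. For a = 0 the predecessor leaves only k = 0. *)
Definition tree_coef a m j : R :=
  \sum_(k < j.+1) 'C((k + a).-1, k)%:R * 2 ^+ k * tree_bin (3 * j) j (m + k).

Lemma tree_coef0 m j : tree_coef 0 m j = tree_bin (3 * j) j m.
Proof.
rewrite /tree_coef big_ord_recl big1 ?addr0 /= ?addn0 ?bin0 ?mul1r//.
by move=> i _; rewrite /bump /= add1n addn0 /= bin_small ?mul0r.
Qed.

(** Counterpart of 1 / (1 - 2 T) = 1 + 2 T / (1 - 2 T). *)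
Lemma tree_coef_rec a m j :
  tree_coef a.+1 m j = tree_coef a m j + 2 * tree_coef a.+1 m.+1 j.
Proof.
(* The term k = 0 is split off the two sums at [m], the term k = j off the sum at [m.+1]; the latter
   is zero as m + 1 + j > j. *)
rewrite /tree_coef big_ord_recl [in RHS]big_ord_recl /= [X in 2 * X]big_ord_recr /=.
have -> : tree_bin (3 * j) j (m.+1 + j) = 0.
  by rewrite /tree_bin ifF//; apply/negbTE; rewrite -ltnNge; lia.
rewrite !bin0 mulr0 addr0 -addrA; congr (_ + _).
rewrite mulr_sumr -big_split; apply: eq_bigr => i _ /=.
rewrite /bump leq0n !add0n !add1n addnS binS natrD exprS addSnnS /=.
by ring.
Qed.

Lemma tree_coef_small a m j : (j < m)%N -> tree_coef a m j = 0.
Proof.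
move=> jm; apply: big1 => k _; rewrite /tree_bin ifF ?mulr0//.
by apply/negbTE; rewrite -ltnNge; lia.
Qed.

Lemma pochhammer_bin a k : (0 < a)%N ->
  pochhammer a%:R k = 'C((k + a).-1, k)%:R * k`!%:R :> R.
Proof.
move=> a0; rewrite /pochhammer; elim: k => [|k IH]; first by rewrite big_ord0 bin0 mul1r.
rewrite big_ord_recr/= IH.
have /(congr1 (fun n => n%:R : R)) := mul_bin_diag (k + a) k.
rewrite (natrM _ (k + a)) (natrM _ k.+1) (factS k) (natrM _ k.+1) => h.
by rewrite mulrA mulrAC (mulrC _ k.+1%:R) -h natrD; ring.
Qed.

(** The binomials C(3j, j - m - k) for k + 1 and k have ratio (j - m - k) / (m + 1 + 2 j + k): one
    new factor of each Pochhammer symbol, with the sign from (- 1)^k. *)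
Lemma pochhammer_tree_bin m j k : (m <= j)%N ->
  'C(3 * j, j - m)%:R * pochhammer (m%:R - j%:R) k * (- 1) ^+ k =
  tree_bin (3 * j) j (m + k) * pochhammer (m.+1%:R + 2 * j%:R) k :> R.
Proof.
move=> mj; elim: k => [|k IH].
  by rewrite /pochhammer !big_ord0 !mulr1 addn0 /tree_bin mj.
rewrite /pochhammer !big_ord_recr/= -!/(pochhammer _ _) exprS.
have -> : 'C(3 * j, j - m)%:R * (pochhammer (m%:R - j%:R) k * (m%:R - j%:R + k%:R)) *
  (-1 * (-1) ^+ k) = ('C(3 * j, j - m)%:R * pochhammer (m%:R - j%:R) k * (- 1) ^+ k)
     * (j%:R - m%:R - k%:R) :> R by ring.
rewrite {}IH.
suff e : tree_bin (3 * j) j (m + k) * (j%:R - m%:R - k%:R) =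
   tree_bin (3 * j) j (m + k.+1) * (m.+1%:R + 2 * j%:R + k%:R).
  by rewrite mulrAC e; ring.
rewrite /tree_bin; case: (ltngtP (m + k) j) => [mkj|mkj|mkj].
- rewrite addnS mkj.
  have := mul_bin_left (3 * j) (j - (m + k).+1).
  rewrite subnSK// => /(congr1 (fun n => n%:R : R)); rewrite !natrM.
  rewrite natrB; last by lia.
  rewrite (_ : (3 * j - (j - (m + k).+1))%N = (m.+1 + 2 * j + k)%N); last by lia.
  rewrite (_ : (m.+1 + 2 * j + k)%:R = m.+1%:R + 2 * j%:R + k%:R); last first.
    by rewrite natrD natrD natrM.
  rewrite natrD => h.
  by rewrite [LHS]mulrC [RHS]mulrC -h; ring.
- rewrite ifF ?mul0r//; apply/negbTE; rewrite -ltnNge; lia.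
rewrite ifF; last by apply/negbTE; rewrite -ltnNge; lia.
by rewrite -mkj natrD; ring.
Qed.

Lemma hyp2F1_tree_coef a m j : (0 < a)%N -> (m <= j)%N ->
  'C(3 * j, j - m)%:R * hyp2F1 a%:R (m%:R - j%:R) (m.+1%:R + 2 * j%:R) (- 2) =
  tree_coef a m j.
Proof.
move=> a0 mj.
pose c := m.+1%:R + 2 * j%:R : R.
have cN0 k : pochhammer c k != 0.
  rewrite /pochhammer; apply/prodf_neq0 => i _.
  by rewrite gt_eqF// /c -natrM -!natrD ltr0n.
have f0 n : (n`!%:R : R) != 0 by rewrite pnatr_eq0 -lt0n fact_gt0.
have term k : 'C(3 * j, j - m)%:R * (pochhammer a%:R k * pochhammer (m%:R - j%:R) k
     / (pochhammer c k * k`!%:R) * (- 2) ^+ k)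
    = 'C((k + a).-1, k)%:R * 2 ^+ k * tree_bin (3 * j) j (m + k) :> R.
  have e := pochhammer_tree_bin k mj; rewrite -/c in e.
  have -> : tree_bin (3 * j) j (m + k) =
     ('C(3 * j, j - m)%:R * pochhammer (m%:R - j%:R) k * (- 1) ^+ k) / pochhammer c k.
    by rewrite e mulfK.
  rewrite pochhammer_bin// (_ : - 2 = -1 * 2 :> R); last by ring.
  rewrite exprMn; field.
  by rewrite cN0 f0.
have C0 : ('C(3 * j, j - m)%:R : R) != 0 by rewrite pnatr_eq0 -lt0n bin_gt0; lia.
(* Termination is read off [term]: its right side vanishes for k > j, and the binomial in front is
   nonzero. *)
have termS k : (j < k)%N -> pochhammer a%:R k * pochhammer (m%:R - j%:R) k
     / (pochhammer c k * k`!%:R) * (- 2) ^+ k = 0 :> R.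
  move=> jk; apply: (mulfI C0); rewrite term mulr0 /tree_bin ifF ?mulr0//.
  by apply/negbTE; rewrite -ltnNge; lia.
rewrite /hyp2F1 -/c.
rewrite (_ : limn _ = \sum_(k < j.+1) pochhammer a%:R k * pochhammer (m%:R - j%:R) k
     / (pochhammer c k * k`!%:R) * (- 2) ^+ k).
  by rewrite mulr_sumr; apply: eq_bigr => k _; exact: term.
apply/cvg_lim => //; apply: cvg_near_cst; exists j.+1 => // n /= jn.
rewrite /series/= big_mkord -(subnKC jn) big_split_ord/= [X in _ + X]big1 ?addr0//.
by move=> i _; apply: termS; rewrite ltnS leq_addr.
Qed.
End TreeBinomials.

(** * Asymptotic expansions of T^m (1 + T) / (1 - 2 T)^(a+1), with [s] for T and [t] for w *)

Section TreeExpansion.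
Context (R : realType) (T : Type) (F : set_system T) {FF : ProperFilter F}.
Context (t : T -> R) (t0 : t @ F --> (0 : R)) (tN0 : \forall m \near F, t m != 0).
Variable (s : T -> R).
Hypothesis s0 : s @ F --> (0 : R).
Hypothesis st : \forall z \near F, s z = t z * (1 + s z) ^+ 3.

Definition tree_fun (a m : nat) (z : T) : R :=
  s z ^+ m * (1 + s z) / (1 - 2 * s z) ^+ a.+1.

Let sN : \forall z \near F, 1 - 2 * s z != 0.
Proof.
have h : 1 - 2 * s z @[z --> F] --> (1 : R).
  rewrite -[X in _ --> X](subr0 (1 : R)) -(mulr0 (2 : R)).
  by apply: cvgB; [exact: cvg_cst|apply: cvgMr].
have nb : \forall y \near (1 : R), y != 0.
  by apply: open_nbhs_nbhs; split; [exact: open_neq|exact: oner_neq0].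
exact: (h _ nb).
Qed.

Let D n f g pf pg := @asymD R T F FF t n f g pf pg.
Let Z n c f pf := @asymZ R T F FF t t0 tN0 n c f pf.

Let cvg_unit_part a k : (1 + s z) ^+ k / (1 - 2 * s z) ^+ a @[z --> F] --> (1 : R).
Proof.
pose p : {poly R} := (1 + 'X) ^+ k; pose q : {poly R} := (1 - 2 *: 'X) ^+ a.
have hp : p.[s z] @[z --> F] --> p.[0] by exact: cvg_horner_t.
have hq : q.[s z] @[z --> F] --> q.[0] by exact: cvg_horner_t.
have p1 : p.[0] = 1 by rewrite /p horner_exp !hornerE expr1n.
have q1 : q.[0] = 1 by rewrite /q horner_exp !hornerE ?mulr0 ?subr0 expr1n.
have q0 : q.[0] != 0 by rewrite q1 oner_neq0.
apply: (cvg_near_eq (cvgM hp (cvgV q0 hq))); first by rewrite p1 q1 divr1.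
by apply: nearW => z /=; rewrite /p /q !horner_exp !hornerE.
Qed.

(** Here s^m = t^m (1 + s)^(3m), of order t^m with m > n. *)
Lemma tree_fun_small a m n : (n < m)%N -> asym F t n (tree_fun a m) 0.
Proof.
move=> nm; apply/(asymP tN0).
exists (fun z => t z ^+ (m - n) * ((1 + s z) ^+ (3 * m).+1 / (1 - 2 * s z) ^+ a.+1)).
  have ht : t z ^+ (m - n) @[z --> F] --> (0 : R).
    have := @cvg_horner_t _ _ _ _ t0 'X^(m - n).
    by rewrite hornerXn expr0n subn_eq0 leqNgt nm/=; under eq_fun => z do rewrite hornerXn.
  apply: (cvg_near_eq (cvgM ht (@cvg_unit_part a.+1 (3 * m).+1))); first by rewrite mul0r.
  exact: nearW.
apply: filterS st => z sz; rewrite /tree_fun horner0 add0r {1}sz exprMn -exprM.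
by rewrite mulrA -exprD subnKC 1?ltnW// !mulrA -[_ * (1 + s z)]mulrA -exprSr.
Qed.

(** Induction on the order takes the place of Lagrange inversion: the equation for [s] writes each
    function, up to the constant 1 when m = 0, as [t] times a combination of functions of the
    family, so order n for these gives order n + 1. *)
Lemma tree_fun0_asym n m :
  asym F t n (tree_fun 0 m) (\poly_(j < n.+1) tree_bin R (3 * j) j m).
Proof.
elim: n m => [|n IH] m.
  apply/(asym0P t0); rewrite coef_poly/=.
  have := @cvg_unit_part 1 1; rewrite /tree_bin => h.
  have hs : s z ^+ m @[z --> F] --> ((0 : R) ^+ m).
    have := @cvg_horner_t _ _ _ _ s0 'X^m.
    by rewrite hornerXn; under eq_fun => z do rewrite hornerXn.
  apply: (cvg_near_eq (cvgM hs h)); last first.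
    by apply: nearW => z /=; rewrite /tree_fun expr1 mulrA.
  by rewrite mulr1 expr0n leqn0; case: m {hs} => //=; rewrite bin0.
have one : asym F t n.+1 (fun=> 1) 1.
  by apply: asym_near (asym_horner tN0 n.+1 1); apply: nearW => z; rewrite hornerC.
case: m => [|m].
  have h := D one (Z 3 (asymtM (FF := FF) tN0 (D (D (IH 0%N) (Z 2 (IH 1%N))) (IH 2%N)))).
  apply: (asym_trunc t0 tN0 _ (asym_near _ h)); last first.
    apply: filterS2 sN st => z zN sz; rewrite /tree_fun !expr1 expr0.
    have -> : t z * (1 * (1 + s z) / (1 - 2 * s z) + 2 * (s z * (1 + s z) / (1 - 2 * s z))
       + s z ^+ 2 * (1 + s z) / (1 - 2 * s z)) = t z * (1 + s z) ^+ 3 / (1 - 2 * s z).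
      by field.
    by rewrite -sz; field.
  case=> [|i] ilt; rewrite coefD coefZ coefXM /= ?coefD ?coefZ !coef_poly /= coefC /=.
    by rewrite /tree_bin/= bin0 mulr0 addr0.
  by rewrite (ltnS i.+1) ilt add0r tree_bin_rec0.
have h := asymtM (FF := FF) tN0 (D (D (D (IH m) (Z 3 (IH m.+1))) (Z 3 (IH m.+2))) (IH m.+3)).
apply: (asym_trunc t0 tN0 _ (asym_near _ h)); last first.
  apply: filterS2 sN st => z zN sz; rewrite /tree_fun expr1.
  rewrite !(exprS (s z)); move: (s z ^+ m) => B.
  transitivity (t z * (1 + s z) ^+ 3 * B * (1 + s z) / (1 - 2 * s z)).
    by field.
  by rewrite -sz; field.
case=> [|i] ilt; rewrite coefXM /= ?coefD ?coefZ !coef_poly //=.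
by rewrite (ltnS i.+1) ilt tree_bin_rec.
Qed.

(** Inside the induction on [a], [m] descends from values above [n], where nothing is left at order
    [n]; the recursion [tree_coef_rec] refers to [m.+1]. *)
Lemma tree_fun_asym a m n :
  asym F t n (tree_fun a m) (\poly_(j < n.+1) tree_coef R a m j).
Proof.
elim: a m => [|a IHa] m.
  apply: (asym_trunc t0 tN0) (tree_fun0_asym n m) => i ilt.
  by rewrite !coef_poly ltnS ilt tree_coef0.
have [d] := ubnP (n.+1 - m); elim: d m => // d IHd m nmd.
have [nm|mn] := ltnP n m.
  apply: (asym_trunc t0 tN0) (tree_fun_small a.+1 nm) => i ilt.
  by rewrite coef0 coef_poly ltnS ilt tree_coef_small// (leq_ltn_trans ilt).
have h := D (IHa m) (Z 2 (IHd m.+1 ltac:(lia))).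
apply: (asym_trunc t0 tN0 _ (asym_near _ h)); last first.
  apply: filterS sN => z zN; rewrite /tree_fun (exprS _ m) (exprS _ a.+1).
  have := expf_neq0 a.+1 zN; move: (_ ^+ a.+1) => B B0; field.
  by rewrite zN B0.
by move=> i ilt; rewrite coefD coefZ !coef_poly ltnS ilt -tree_coef_rec.
Qed.

Lemma tree_asym n : asym F t n (fun z => 1 + s z)
  (\poly_(j < n.+1) ((3 * j)`!%:R / (j`!%:R * (2 * j + 1)`!%:R))).
Proof.
have h := D (tree_fun0_asym n 0) (Z (- 2) (tree_fun0_asym n 1)).
apply: (asym_trunc t0 tN0 _ (asym_near _ h)); last first.
  by apply: filterS sN => z zN; rewrite /tree_fun; field.
move=> i ilt; rewrite coefD coefZ !coef_poly ltnS ilt -tree_bin_fact; ring.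
Qed.
End TreeExpansion.

(** * Equations at fixed u; [r0], [r1], [r2] stand for r_0, r_2, r_4 *)

Lemma sextic_string_equation (R : realType) (N : nat) (u : R)
    (P : nat -> {poly R}) (rec : nat -> R) : (0 < N)%N -> 0 < u ->
  monic_orthogonal (sextic_weight N u) P -> recurrence_coefs P rec ->
  forall n, n.+3%:R / N%:R = rec n.+3 *
    (1 + u * string_sum (rec n.+1) (rec n.+2) (rec n.+3) (rec n.+4) (rec n.+4.+1)).
Proof.
move=> N0 u0 [Pm Po] Pr n.
apply: (@string_equation R (weight_int N u) P) => //.
- exact: weight_intD.
- exact: weight_intZ.
- exact: weight_int_sqr_neq0.
- move=> i j ij; rewrite /weight_int /Rintegral.
  have <- : fine 0%E = 0 :> R by [].
  rewrite -(Po i j ij); congr fine.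
  by apply: eq_integral => z _; rewrite hornerM.
- exact: weight_int_deriv.
Qed.

(** As eps <= 1 makes x nonnegative, the fractions floor(x (m+1)) / (m+1) of natural numbers tend to
    x. *)
Lemma rational_dense_eq0 (R : realType) (f : R -> R) (eps : R) : eps <= 1 ->
  (forall x, `|x - 1| < eps -> {for x, continuous f}) ->
  (forall p q : nat, (0 < q)%N -> `|p%:R / q%:R - 1| < eps -> f (p%:R / q%:R) = 0) ->
  forall x, `|x - 1| < eps -> f x = 0.
Proof.
move=> eps1 cf f0 x xe.
have x0 : 0 <= x by move: xe; rewrite ltr_norml; lra.
pose s (m : nat) : R := (Num.truncn (x * m.+1%:R))%:R / m.+1%:R.
have sx : s @ \oo --> x.
  apply/cvgrPdist_le => e e0; near=> m.
  have m0 : (0 : R) < m.+1%:R by rewrite ltr0n.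
  have /andP[h1 h2] := truncn_itv (mulr_ge0 x0 (ltW m0)).
  have me : m.+1%:R^-1 <= e.
    rewrite ltW//; near: m; exact: near_infty_natSinv_lt (PosNum e0).
  have -> : x = x * m.+1%:R / m.+1%:R by rewrite mulfK// gt_eqF.
  rewrite /s -mulrBl ger0_norm; last by rewrite mulr_ge0 ?subr_ge0// invr_ge0 ltW.
  apply: le_trans me; rewrite ler_piMl ?invr_ge0 ?ltW//.
  by rewrite ltrBlDr nat1r.
have fs : f (s m) @[m --> \oo] --> f x by apply: cvg_comp sx (cf x xe).
suff h : f (s m) @[m --> \oo] --> (0 : R) by exact: (cvg_unique _ fs h).
apply: cvg_near_cst.
have se : \forall m \near \oo, `|s m - 1| < eps.
  have : `|s m - 1| @[m --> \oo] --> `|x - 1|.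
    by apply: cvg_norm; apply: cvgB => //; exact: cvg_cst.
  by move=> /cvgr_lt; apply.
by apply: filterS se => m; exact: f0.
Unshelve. all: by end_near. Qed.

Section FixedParameter.
Context (R : realType) (u eps : R) (rec : nat -> nat -> R) (r0 r1 r2 : R -> R).
Hypotheses (u0 : 0 < u) (eps1 : eps <= 1).
Hypothesis string : forall N n : nat, (0 < N)%N -> n.+3%:R / N%:R = rec N n.+3 *
  (1 + u * string_sum (rec N n.+1) (rec N n.+2) (rec N n.+3) (rec N n.+4) (rec N n.+4.+1)).
Hypotheses (c0 : forall x, `|x - 1| < eps -> {for x, continuous r0})
  (c1 : forall x, `|x - 1| < eps -> {for x, continuous r1})
  (c2 : forall x, `|x - 1| < eps -> {for x, continuous r2}).
Hypothesis expn : exists C : R, exists N0 : nat, forall N n : nat,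
  (0 < N)%N -> (N0 <= N)%N -> `|n%:R / N%:R - 1| < eps ->
  `|rec N n - (r0 (n%:R / N%:R) + r1 (n%:R / N%:R) * N%:R ^- 2
     + r2 (n%:R / N%:R) * N%:R ^- 4)| <= C * N%:R ^- 6.

Section RationalPoint.
Variables (p q : nat).
Hypothesis q0 : (0 < q)%N.
Local Notation x := (p%:R / q%:R : R).
Hypothesis xe : `|x - 1| < eps.

Let N m := (q * m.+1)%N.
Let n m := (p * m.+1)%N.
Let t m : R := (N m)%:R^-1.
(** The five neighbours of R_n, i = 2 being the centre. The truncated subtraction is a true one for
    all large [m]. *)
Let a (i m : nat) : R := rec (N m) (n m - 2 + i).
Let k (i : nat) : R := i%:R - 2.

Let N0 m : (0 < N m)%N. Proof. by rewrite muln_gt0 q0. Qed.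

Let t0 : t @ \oo --> (0 : R).
Proof.
have h : (fun m => q%:R^-1 * m.+1%:R^-1 : R) @ \oo --> (0 : R).
  rewrite -(mulr0 (q%:R^-1 : R)); apply: cvgMr; exact: cvg_harmonic.
apply: (cvg_near_eq h) => //; apply: nearW => m.
by rewrite /t /N natrM invfM.
Qed.

Let tN0 : \forall m \near \oo, t m != 0.
Proof. by apply: nearW => m; rewrite invr_eq0 pnatr_eq0 -lt0n. Qed.

Let p_gt0 : (0 < p)%N.
Proof.
rewrite lt0n; apply/eqP => p0; move: xe.
by rewrite p0 mul0r sub0r normrN normr1 ltNge eps1.
Qed.

Let xE m : (n m)%:R / (N m)%:R = x.
Proof.
rewrite /n /N !natrM; field.
by rewrite nat1r !pnatr_eq0 -lt0n q0.
Qed.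

Let pointE i : \forall m \near \oo, (n m - 2 + i)%:R / (N m)%:R = x + k i * t m.
Proof.
exists 2%N => // m /= m2.
rewrite natrD natrB; last by rewrite /n; move: p_gt0; nia.
by rewrite -(xE m) /t /k; ring.
Qed.

Let point_cvg i : x + k i * t m @[m --> \oo] --> x.
Proof.
rewrite -[X in _ --> X]addr0 -(mulr0 (k i)).
by apply: cvgD; [exact: cvg_cst|apply: cvgMr].
Qed.

Let point_in i : \forall m \near \oo, `|x + k i * t m - 1| < eps.
Proof.
have : `|x + k i * t m - 1| @[m --> \oo] --> `|x - 1|.
  by apply: cvg_norm; apply: cvgB => //; exact: cvg_cst.
by move=> /cvgr_lt; apply.
Qed.

(** Powers of [t] are nested so that each factor raises the order by one through [asymtM]. *)
Let aE i : exists2 e : nat -> R, asym \oo t 4 e 0 & \forall m \near \oo,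
  a i m = r0 (x + k i * t m) + t m * (t m * r1 (x + k i * t m))
   + t m * (t m * (t m * (t m * r2 (x + k i * t m)))) + e m.
Proof.
have [C [M0 h]] := expn.
exists (fun m => a i m - (r0 (x + k i * t m) + t m * (t m * r1 (x + k i * t m))
   + t m * (t m * (t m * (t m * r2 (x + k i * t m)))))); last first.
  by apply: nearW => m; rewrite addrC subrK.
apply: (@asym_le _ _ _ _ _ t0 tN0 5) => //.
apply: (@asym_O _ _ _ _ _ t0 tN0 _ C).
near=> m.
have pe : (n m - 2 + i)%:R / (N m)%:R = x + k i * t m by near: m; exact: pointE.
have pin : `|x + k i * t m - 1| < eps by near: m; exact: point_in.
have := h (N m) (n m - 2 + i)%N (N0 m); rewrite pe.
have NM : (M0 <= N m)%N.
  near: m; exists M0 => // m /= mM; rewrite /N; move: q0; nia.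
move=> /(_ NM pin); rewrite horner0 subr0 (ger0_norm (_ : 0 <= t m)) ?invr_ge0//.
rewrite /a /t !exprVn; congr (_ <= _); congr (`| _ - _|).
by rewrite -!exprVn; ring.
Unshelve. all: by end_near. Qed.

Let stringE : \forall m \near \oo,
  x = a 2%N m * (1 + u * string_sum (a 0%N m) (a 1%N m) (a 2%N m) (a 3%N m) (a 4%N m)).
Proof.
exists 3%N => // m /= m3; rewrite -(xE m).
have n3 : (3 <= n m)%N by rewrite /n; move: p_gt0; nia.
have := string (n m - 3) (N0 m); rewrite /a.
have -> : (n m - 2 + 0)%N = (n m - 3).+1 by lia.
have -> : (n m - 2 + 1)%N = (n m - 3).+2 by lia.
have -> : (n m - 2 + 2)%N = (n m - 3).+3 by lia.
have -> : (n m - 2 + 3)%N = (n m - 3).+4 by lia.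
have -> : (n m - 2 + 4)%N = (n m - 3).+4.+1 by lia.
have e : (n m - 3).+3 = n m by lia.
by move=> <-; rewrite e.
Qed.

Let point_comp (r : R -> R) i : {for x, continuous r} ->
  r (x + k i * t m) @[m --> \oo] --> r x.
Proof. by move=> cr; apply: cvg_comp (point_cvg i) cr. Qed.

Let asym_const (f : nat -> R) (c : R) : f @ \oo --> c -> asym \oo t 0 f c%:P.
Proof. by move=> fc; apply/(asym0P t0); rewrite coefC. Qed.

Let D j f g pf pg := @asymD R nat \oo _ t j f g pf pg.
Let M j f pf := @asymtM R nat \oo _ t tN0 j f pf.

Let L j l f pf := @asym_le R nat \oo _ t t0 tN0 j l f pf.

(** The factor t^4 turns the mere limit of r_4 into an expansion of order 4. *)
Let r2_asym i := M (M (M (M (asym_const (point_comp i (c2 xe)))))).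

Lemma rational_genus0 : r0 x + 10 * u * r0 x ^+ 3 = x.
Proof.
apply: (genus0_string t0 tN0 stringE) => i _.
have [e e0 ae] := aE i.
have h0 := asym_const (point_comp i (c0 xe)).
have h1 := L (leq0n _) (M (M (asym_const (point_comp i (c1 xe))))).
have h2 := L (leq0n _) (r2_asym i).
have he := L (leq0n _) e0.
have h : asym \oo t 0 (a i) (r0 x)%:P.
  apply: (asym_trunc t0 tN0 _ (asym_near _ (D (D (D h0 h1) h2) he))); last first.
    by apply: filterS ae => m ->.
  by case=> // _; rewrite !coefD coefC !coefXM coef0 !addr0.
by move/(asym0P t0): h; rewrite coefC.
Qed.

(** Assumed at all nearby points, because the Taylor polynomial of r_0 uses the equation at the
    shifted points x + k t; [genus0_equation] will supply it. *)
Hypothesis genus0 : forall z, `|z - 1| < eps -> r0 z + 10 * u * r0 z ^+ 3 = z.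

Let r0_asym i : asym \oo t 4 (fun m => r0 (x + k i * t m)) (genus0_taylor u (r0 x) (k i)).
Proof.
apply: (genus0_taylorP t0 tN0 u0 (genus0 xe)).
by apply: filterS (point_in i) => m; exact: genus0.
Qed.

Lemma rational_genus1 :
  r1 x * (1 + 30 * u * r0 x ^+ 2) ^+ 4 = - (5 * u * r0 x * (1 - 90 * u * r0 x ^+ 2)).
Proof.
apply: (genus1_string t0 tN0 u0 stringE (genus0 xe)) => i _.
have [e e0 ae] := aE i.
have h0 := L (isT : (2 <= 4)%N) (r0_asym i).
have h1 := M (M (asym_const (point_comp i (c1 xe)))).
have h2 := L (isT : (2 <= 4)%N) (r2_asym i).
have he := L (isT : (2 <= 4)%N) e0.
apply: (asym_trunc t0 tN0 _ (asym_near _ (D (D (D h0 h1) h2) he))); last first.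
  by apply: filterS ae => m ->.
move=> j j2.
rewrite !coefD !coefXM !coefC ?coef0 coefZ coefXn.
by case: j j2 => [|[|[|//]]] _ /=; rewrite ?mulr0 ?mulr1 ?addr0.
Qed.

Hypothesis genus1 : forall z, `|z - 1| < eps ->
  r1 z * (1 + 30 * u * r0 z ^+ 2) ^+ 4 = - (5 * u * r0 z * (1 - 90 * u * r0 z ^+ 2)).

Lemma rational_genus2 : let v := 10 * u * r0 x ^+ 2 in
  r2 x * (1 + 30 * u * r0 x ^+ 2) ^+ 9 = 5 * u ^+ 2 * r0 x * (59 * (1 + v) ^+ 3
    - (4 * 10 ^+ 3 + 11) * v * (1 + v) ^+ 2
    + (27 * 10 ^+ 3 + 528) * v ^+ 2 * (1 + v) - (34 * 10 ^+ 3 + 268) * v ^+ 3).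
Proof.
have y0 : r0 x != 0.
  apply/eqP => y0; have := genus0 xe; rewrite y0 expr0n/= mulr0 addr0 => x0.
  by move: xe; rewrite -x0 sub0r normrN normr1 ltNge eps1.
apply: (genus2_string t0 tN0 u0 stringE y0 (genus0 xe)) => i _.
have [e e0 ae] := aE i.
have h1 : asym \oo t 2 (fun m => r1 (x + k i * t m)) (genus1_taylor u (r0 x) (k i)).
  apply: (genus1_taylorP t0 tN0 u0 (f := fun m => r0 (x + k i * t m)) (genus0 xe)).
    by apply: filterS (point_in i) => m; exact: genus0.
  by apply: filterS (point_in i) => m; exact: genus1.
apply: (asym_trunc t0 tN0 _ (asym_near _
  (D (D (D (r0_asym i) (M (M h1))) (r2_asym i)) e0))); last first.
  by apply: filterS ae => m ->.
move=> j _; congr (nth _ _ _).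
have X2 (g : {poly R}) : 'X * ('X * g) = 'X^2 * g by rewrite mulrA -expr2.
by rewrite addr0 !X2 mulrA -exprD -mul_polyC (mulrC (r2 x)%:P).
Qed.
End RationalPoint.

Let cvg_poly_r0 (P : {poly R}) x : `|x - 1| < eps ->
  {for x, continuous (fun z => P.[r0 z])}.
Proof. by move=> /c0 h; apply: cvg_comp h _; exact: continuous_horner. Qed.

Lemma genus0_equation x : `|x - 1| < eps -> r0 x + 10 * u * r0 x ^+ 3 = x.
Proof.
move=> xe; apply/eqP; rewrite -subr_eq0; apply/eqP; move: x xe.
apply: rational_dense_eq0 => //.
  move=> x xe; have h := @cvg_poly_r0 ('X + (10 * u) *: 'X^3) x xe.
  apply: (cvg_near_eq (cvgB h cvg_id)).
    by rewrite !hornerE.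
  by apply: nearW => z; rewrite !fctE !hornerE.
by move=> p q q0 xe; rewrite rational_genus0// subrr.
Qed.

Lemma genus1_equation x : `|x - 1| < eps ->
  r1 x * (1 + 30 * u * r0 x ^+ 2) ^+ 4 = - (5 * u * r0 x * (1 - 90 * u * r0 x ^+ 2)).
Proof.
move=> xe; apply/eqP; rewrite -subr_eq0; apply/eqP; move: x xe.
apply: rational_dense_eq0 => //.
  move=> x xe; have h := @cvg_poly_r0 ((1 + (30 * u) *: 'X^2) ^+ 4) x xe.
  have h' := @cvg_poly_r0 (- ((5 * u) *: 'X * (1 - (90 * u) *: 'X^2))) x xe.
  apply: (cvg_near_eq (cvgB (cvgM (c1 xe) h) h')).
    by rewrite !horner_exp !hornerE.
  by apply: nearW => z; rewrite !fctE /= !horner_exp !hornerE.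
move=> p q q0 xe; rewrite rational_genus1// ?subrr//; exact: genus0_equation.
Qed.

Lemma genus2_equation x : `|x - 1| < eps -> let v := 10 * u * r0 x ^+ 2 in
  r2 x * (1 + 30 * u * r0 x ^+ 2) ^+ 9 = 5 * u ^+ 2 * r0 x * (59 * (1 + v) ^+ 3
    - (4 * 10 ^+ 3 + 11) * v * (1 + v) ^+ 2
    + (27 * 10 ^+ 3 + 528) * v ^+ 2 * (1 + v) - (34 * 10 ^+ 3 + 268) * v ^+ 3).
Proof.
move=> xe v; apply/eqP; rewrite -subr_eq0 /v {v}; apply/eqP; move: x xe.
apply: rational_dense_eq0 => //.
  move=> x xe; have h := @cvg_poly_r0 ((1 + (30 * u) *: 'X^2) ^+ 9) x xe.
  pose v : {poly R} := (10 * u) *: 'X^2.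
  have h' := @cvg_poly_r0 ((5 * u ^+ 2) *: 'X * (59 *: (1 + v) ^+ 3
    - (4 * 10 ^+ 3 + 11) *: v * (1 + v) ^+ 2
    + (27 * 10 ^+ 3 + 528) *: v ^+ 2 * (1 + v) - (34 * 10 ^+ 3 + 268) *: v ^+ 3)) x xe.
  have hE := (hornerD, hornerN, hornerZ, hornerM, horner_exp, hornerXn, hornerX, hornerC).
  apply: (cvg_near_eq (cvgB (cvgM (c2 xe) h) h')).
    by rewrite !hE.
  by apply: nearW => z; rewrite !fctE /= !hE.
move=> p q q0 xe; rewrite (rational_genus2 q0 xe) ?subrr//.
- exact: genus0_equation.
- exact: genus1_equation.
Qed.
End FixedParameter.

(** * Expansions of r_0, r_2, r_4 as u tends to 0 from the right, at fixed x *)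

Lemma asym_scale (R : realType) (T : Type) (F : set_system T)
    (FF : ProperFilter F) (t : T -> R) (c : R) n (f : T -> R) (b : nat -> R) :
  c != 0 -> asym F (fun z => c * t z) n f (\poly_(j < n.+1) b j) ->
  asym F t n f (\poly_(j < n.+1) (c ^+ j * b j)).
Proof.
rewrite /asym => c0 h.
apply: (cvg_near_eq (cvgM (cvg_cst (c ^+ n)) h)); first by rewrite mulr0.
apply: nearW => z /=; rewrite !horner_poly exprMn invfM.
have cn : c ^+ n != 0 by rewrite expf_neq0.
rewrite mulrCA !mulrA mulfK//; congr (_ / _); congr (_ - _).
by apply: eq_bigr => i _; rewrite exprMn; ring.
Qed.

Section FixedPoint.
Context (R : realType) (x : R) (r0 r1 r2 : R -> R).
Hypothesis x0 : 0 < x.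
Hypothesis e0 : \forall u \near (0 : R)^'+, r0 u + 10 * u * r0 u ^+ 3 = x.
Hypothesis e1 : \forall u \near (0 : R)^'+,
  r1 u * (1 + 30 * u * r0 u ^+ 2) ^+ 4 = - (5 * u * r0 u * (1 - 90 * u * r0 u ^+ 2)).
Hypothesis e2 : \forall u \near (0 : R)^'+, let v := 10 * u * r0 u ^+ 2 in
  r2 u * (1 + 30 * u * r0 u ^+ 2) ^+ 9 = 5 * u ^+ 2 * r0 u * (59 * (1 + v) ^+ 3
    - (4 * 10 ^+ 3 + 11) * v * (1 + v) ^+ 2
    + (27 * 10 ^+ 3 + 528) * v ^+ 2 * (1 + v) - (34 * 10 ^+ 3 + 268) * v ^+ 3).

Let c : R := - (10 * x ^+ 2).
Let t (u : R) : R := c * u.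
Let s (u : R) : R := r0 u / x - 1.

Let xN0 : x != 0. Proof. by rewrite gt_eqF. Qed.

Let c_neq0 : c != 0.
Proof. by rewrite oppr_eq0 mulf_neq0 ?expf_neq0// pnatr_eq0. Qed.

Let t0 : t @ (0 : R)^'+ --> (0 : R).
Proof.
rewrite -[X in _ --> X](mulr0 c); apply: cvgMr.
exact: cvg_at_right_filter.
Qed.

Let tN0 : \forall u \near (0 : R)^'+, t u != 0.
Proof. by near=> u; rewrite mulf_neq0// gt_eqF. Unshelve. all: by end_near. Qed.

Let r0E u : r0 u = x * (1 + s u).
Proof. by rewrite /s; field. Qed.

Let st : \forall u \near (0 : R)^'+, s u = t u * (1 + s u) ^+ 3.
Proof.
apply: filterS e0 => u eu; apply: (mulfI xN0).
have -> : x * s u = r0 u - x by rewrite /s; field.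
rewrite -[X in _ - X]eu /t /c r0E; ring.
Qed.

(* [r0 u (1 + 10 u (r0 u)^2) = x] with [u > 0] forces [0 < r0 u <= x]. *)
Let s_bound : \forall u \near (0 : R)^'+, 0 < 1 + s u <= 1.
Proof.
near=> u.
have u0 : 0 < u by [].
have eu : r0 u + 10 * u * r0 u ^+ 3 = x by near: u.
have q1 : 0 <= u * r0 u ^+ 2 by rewrite mulr_ge0 ?sqr_ge0// ltW.
have eu' : r0 u * (1 + 10 * (u * r0 u ^+ 2)) = x by rewrite -[RHS]eu; ring.
have y0 : 0 < r0 u by rewrite -(pmulr_lgt0 (x := 1 + 10 * (u * r0 u ^+ 2))) ?eu'//; lra.
rewrite /s subrKC divr_gt0//= ler_pdivrMr// mul1r -eu' ler_pMr//; lra.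
Unshelve. all: by end_near. Qed.

Let s0 : s @ (0 : R)^'+ --> (0 : R).
Proof.
apply: norm_cvg0.
apply: (@squeeze_cvgr _ _ _ _ (cst 0) (fun u => `|t u|)).
- apply: filterS2 st s_bound => u su /andP[b0 b1].
  rewrite normr_ge0/= [in leLHS]su normrM ler_piMr//.
  by rewrite ger0_norm ?exprn_ile1// ?exprn_ge0// ltW.
- exact: cvg_cst.
- by have := cvg_norm t0; rewrite normr0; apply.
Qed.

Let FF : ProperFilter (0 : R)^'+ := _.
Let Ts := @tree_fun_asym R R (0 : R)^'+ FF t t0 tN0 s s0 st.
Let D n f g pf pg := @asymD R R (0 : R)^'+ FF t n f g pf pg.
Let Z n d f pf := @asymZ R R (0 : R)^'+ FF t t0 tN0 n d f pf.

Lemma genus0_asym n : asym (0 : R)^'+ id n r0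
  (\poly_(j < n.+1) (c ^+ j * (x * ((3 * j)`!%:R / (j`!%:R * (2 * j + 1)`!%:R))))).
Proof.
apply: asym_scale => //.
have h := Z x (@tree_asym R R (0 : R)^'+ FF t t0 tN0 s s0 st n).
apply: (asym_trunc t0 tN0 _ (asym_near _ h)); last by apply: nearW => u; rewrite r0E.
by move=> i ilt; rewrite coefZ !coef_poly ltnS ilt.
Qed.

Let sN u : 0 < 1 + s u <= 1 -> (1 + s u != 0) && (1 - 2 * s u != 0).
Proof. by move=> /andP[h1 h2]; rewrite !gt_eqF//; lra. Qed.

Let uE u : 1 + s u != 0 -> s u = t u * (1 + s u) ^+ 3 ->
  u = - s u / (10 * x ^+ 2 * (1 + s u) ^+ 3).
Proof. by move=> h {1}->; rewrite /t /c; field; rewrite xN0 h. Qed.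

Lemma genus1_asym n : asym (0 : R)^'+ id n r1
  (\poly_(j < n.+1) (c ^+ j * ((2 * x)^-1 * (10 * tree_coef R 3 2 j + tree_coef R 3 1 j)))).
Proof.
apply: asym_scale => //.
have h := Z (2 * x)^-1 (D (Z 10 (Ts 3 2 n)) (Ts 3 1 n)).
apply: (asym_trunc t0 tN0 _ (asym_near _ h)); last first.
  apply: filterS3 st s_bound e1 => u su /sN/andP[n1 n2] eu.
  have uu := uE n1 su.
  have A0 : (1 - 2 * s u) / (1 + s u) != 0 by rewrite mulf_neq0 ?invr_eq0.
  apply: (mulIf (expf_neq0 4 A0)); move: eu; rewrite r0E.
  have -> : 1 + 30 * u * (x * (1 + s u)) ^+ 2 = (1 - 2 * s u) / (1 + s u).
    (* Once u is eliminated, the equation reads r_2 = (T + 10 T^2) (1 + T) / (2 x (1 - 2 T)^4). *)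
    by rewrite {1}uu; field; rewrite xN0 n1.
  have -> : 5 * u * (x * (1 + s u)) = - s u / (2 * x * (1 + s u) ^+ 2).
    by rewrite {1}uu; field; rewrite xN0 n1.
  have -> : 90 * u * (x * (1 + s u)) ^+ 2 = - (9 * s u) / (1 + s u).
    by rewrite {1}uu; field; rewrite xN0 n1.
  move=> ->; rewrite /tree_fun.
  move: (s u) n1 n2 => S n1 n2; field.
  by rewrite xN0 n1 n2.
by move=> i ilt; rewrite coefZ coefD coefZ !coef_poly ltnS ilt.
Qed.

Lemma genus2_asym n : asym (0 : R)^'+ id n r2
  (\poly_(j < n.+1) (c ^+ j * ((20 * x ^+ 3)^-1 * (59 * tree_coef R 8 2 j
    + (4 * 10 ^+ 3 + 11) * tree_coef R 8 3 j + (27 * 10 ^+ 3 + 528) * tree_coef R 8 4 j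
    + (34 * 10 ^+ 3 + 268) * tree_coef R 8 5 j)))).
Proof.
apply: asym_scale => //.
have h := Z (20 * x ^+ 3)^-1 (D (D (D (Z 59 (Ts 8 2 n)) (Z (4 * 10 ^+ 3 + 11) (Ts 8 3 n)))
  (Z (27 * 10 ^+ 3 + 528) (Ts 8 4 n))) (Z (34 * 10 ^+ 3 + 268) (Ts 8 5 n))).
apply: (asym_trunc t0 tN0 _ (asym_near _ h)); last first.
  apply: filterS3 st s_bound e2 => u su /sN/andP[n1 n2] eu.
  have uu := uE n1 su.
  have A0 : (1 - 2 * s u) / (1 + s u) != 0 by rewrite mulf_neq0 ?invr_eq0.
  apply: (mulIf (expf_neq0 9 A0)); move: eu; rewrite /= r0E.
  have -> : 1 + 30 * u * (x * (1 + s u)) ^+ 2 = (1 - 2 * s u) / (1 + s u).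
    by rewrite {1}uu; field; rewrite xN0 n1.
  have -> : 10 * u * (x * (1 + s u)) ^+ 2 = - s u / (1 + s u).
    by rewrite {1}uu; field; rewrite xN0 n1.
  have -> : 5 * u ^+ 2 * (x * (1 + s u)) = s u ^+ 2 / (20 * x ^+ 3 * (1 + s u) ^+ 5).
    by rewrite {1}uu; field; rewrite xN0 n1.
  move=> ->; rewrite /tree_fun.
  move: (s u) n1 n2 => S n1 n2; field.
  by rewrite xN0 n1 n2.
by move=> i ilt; rewrite coefZ !coefD !coefZ !coef_poly ltnS ilt.
Qed.
End FixedPoint.

(** * Identification of the coefficients with the stated formulas *)

Section Beta.
Context (R : realType) (x : R).
Hypothesis xN0 : x != 0.
Local Notation c := (- (10 * x ^+ 2)).

Let cE j : c ^+ j = (- 10) ^+ j * x ^+ (2 * j).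
Proof. by rewrite -mulNr exprMn -exprM. Qed.

Lemma beta0E j :
  c ^+ j * (x * ((3 * j)`!%:R / (j`!%:R * (2 * j + 1)`!%:R))) = beta0 j x.
Proof.
rewrite cE /beta0 [x ^+ (2 * j + 1)]exprD expr1.
by move: (_ / _) (x ^+ _) (_ ^+ _) => A B C; ring.
Qed.

Lemma beta2E j : (0 < j)%N ->
  c ^+ j * ((2 * x)^-1 * (10 * tree_coef R 3 2 j + tree_coef R 3 1 j)) = beta2 j x.
Proof.
(* At j = 1 the general formula fails: truncated j - 2 leaves the binomial 1, and 2F1 with parameter
   2 - j = 1 does not terminate. The true contribution is 0. The cases j = 2, 3, 4 of [beta4] are of
   the same kind. *)
move=> j0; rewrite /beta2; case: eqP => [->|j1].
  have -> : tree_coef R 3 2 1 = 0 by exact: tree_coef_small.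
  have -> : tree_coef R 3 1 1 = 1.
    by rewrite /tree_coef !big_ord_recl big_ord0 /tree_bin/= !bin0; ring.
  by rewrite expr1; field.
have j2 : (1 < j)%N by lia.
rewrite -(mulrA 10) (hyp2F1_tree_coef R (isT : 0 < 3)%N j2).
rewrite (hyp2F1_tree_coef R (isT : 0 < 3)%N j0) cE.
have -> : x ^+ (2 * j) = x ^+ (2 * j - 1) * x by rewrite -exprSr; congr (_ ^+ _); lia.
by field.
Qed.

Lemma beta4E j : (1 < j)%N ->
  c ^+ j * ((20 * x ^+ 3)^-1 * (59 * tree_coef R 8 2 j
    + (4 * 10 ^+ 3 + 11) * tree_coef R 8 3 j + (27 * 10 ^+ 3 + 528) * tree_coef R 8 4 j
    + (34 * 10 ^+ 3 + 268) * tree_coef R 8 5 j)) = beta4 j x.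
Proof.
move=> j1; rewrite /beta4.
case: eqP => [->|j2].
  have -> : tree_coef R 8 3 2 = 0 by exact: tree_coef_small.
  have -> : tree_coef R 8 4 2 = 0 by exact: tree_coef_small.
  have -> : tree_coef R 8 5 2 = 0 by exact: tree_coef_small.
  have -> : tree_coef R 8 2 2 = 1.
    by rewrite /tree_coef !big_ord_recl big_ord0 /tree_bin/= !bin0; ring.
  by field.
case: eqP => [->|j3].
  have -> : tree_coef R 8 4 3 = 0 by exact: tree_coef_small.
  have -> : tree_coef R 8 5 3 = 0 by exact: tree_coef_small.
  have -> : tree_coef R 8 2 3 = 25.
    by rewrite /tree_coef !big_ord_recl big_ord0 /tree_bin/= !bin1 !bin0; ring.
  have -> : tree_coef R 8 3 3 = 1.
    by rewrite /tree_coef !big_ord_recl big_ord0 /tree_bin/= !bin0; ring.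
  by field.
case: eqP => [->|j4].
  have -> : tree_coef R 8 5 4 = 0 by exact: tree_coef_small.
  (* 402 = 66 + 16 * 12 + 144: the coefficients 1, 16, 144 of (1 - 2 T)^(-8) against C(12,2),
     C(12,1), C(12,0). *)
  have -> : tree_coef R 8 2 4 = 402.
    rewrite /tree_coef !big_ord_recl big_ord0 /tree_bin/= /bump/= !bin1 !bin0.
    rewrite (_ : 'C(3 * 4, 4 - (2 + 0)) = 66%N)//.
    by rewrite (_ : 'C(0 + (1 + 0) + 8, 1 + (1 + 0)) = 36%N)//; ring.
  have -> : tree_coef R 8 3 4 = 28.
    by rewrite /tree_coef !big_ord_recl big_ord0 /tree_bin/= /bump/= !bin1 !bin0; ring.
  have -> : tree_coef R 8 4 4 = 1.
    by rewrite /tree_coef !big_ord_recl big_ord0 /tree_bin/= !bin0; ring.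
  by field.
have h2 : (2 <= j)%N by lia.
have h3 : (3 <= j)%N by lia.
have h4 : (4 <= j)%N by lia.
have h5 : (5 <= j)%N by lia.
rewrite -(mulrA 59) -!(mulrA (_ + _)).
rewrite (hyp2F1_tree_coef R (isT : 0 < 8)%N h2) (hyp2F1_tree_coef R (isT : 0 < 8)%N h3).
rewrite (hyp2F1_tree_coef R (isT : 0 < 8)%N h4) (hyp2F1_tree_coef R (isT : 0 < 8)%N h5) cE.
have -> : x ^+ (2 * j) = x ^+ (2 * j - 3) * x ^+ 3.
  by rewrite -exprD; congr (_ ^+ _); lia.
by field.
Qed.
End Beta.

(** * Power series in u, and the conclusion *)

(** The expansion at 0+ identifies the coefficients of a power series already known to converge for
    |u| < rho; this is how the result reaches u <= 0. *)
Lemma analytic_expansion (R : realType) (f : R -> R -> R) (c : nat -> nat -> R)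
    (rho x : R) (b : nat -> R) : 0 < rho ->
  (forall z u, `|z - 1| < rho -> `|u - 0| < rho ->
    let t i j := c i j * (z - 1) ^+ i * (u - 0) ^+ j in
    cvgn (square_sum (fun i j => `|t i j|)) /\ square_sum t @ \oo --> f z u) ->
  `|x - 1| < rho ->
  (forall n, asym (0 : R)^'+ id n (f x) (\poly_(j < n.+1) b j)) ->
  forall u, `|u| < rho -> \sum_(j < m) b j * u ^+ j @[m --> \oo] --> f x u.
Proof.
move=> rho0 fc xr fb u ur.
have cols v : `|v| < rho ->
    \sum_(j < m) column_series 1 c x j * v ^+ j @[m --> \oo] --> f x v.
  move=> vr; have := analytic_columns rho0 fc xr (u := v).
  by rewrite subr0; apply.
have colE j : column_series 1 c x j = b j.
  have h : asym (0 : R)^'+ id j (f x) (\poly_(i < j.+1) column_series 1 c x i).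
    apply: power_series_asym rho0 _ => v /andP[v0 vr].
    by apply: cols; rewrite gtr0_norm.
  have idc : id @ (0 : R)^'+ --> (0 : R) by exact: cvg_at_right_filter.
  have idN : \forall v \near (0 : R)^'+, id v != 0 by near=> v; rewrite gt_eqF.
  suff : (\poly_(i < j.+1) column_series 1 c x i)`_j = (\poly_(i < j.+1) b i)`_j.
    by rewrite !coef_poly ltnSn.
  exact: (asym_uniq idc idN h (fb j)).
apply: (cvg_near_eq (cols u ur)) => //; apply: nearW => m.
by apply: eq_bigr => j _; rewrite colE.
Unshelve. all: by end_near. Qed.

Section Topological.
Context (R : realType) (P : nat -> R -> nat -> {poly R}) (rec : nat -> R -> nat -> R)
  (r : nat -> R -> R -> R).
Hypotheses
  (P_orth : forall (N : nat) (u : R), (0 < N)%N -> 0 < u ->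
     monic_orthogonal (sextic_weight N u) (P N u))
  (P_rec : forall (N : nat) (u : R), (0 < N)%N -> 0 < u ->
     recurrence_coefs (P N u) (rec N u)).
Variables (delta eps : R).
Hypothesis r_exp : forall u : R, 0 < u < delta -> forall K : nat,
  exists C : R, exists N0 : nat, forall N n : nat,
    (0 < N)%N -> (N0 <= N)%N -> `|n%:R / N%:R - 1| < delta ->
    `|rec N u n - \sum_(g < K.+1) r g (n%:R / N%:R) u * N%:R ^- (2 * g)|
      <= C * N%:R ^- (2 * K.+1).
Hypotheses (eps1 : eps <= 1) (eps_delta : eps <= delta).
Hypothesis r_cont : forall g x u, (g < 3)%N -> `|x - 1| < eps -> `|u| < eps ->
  {for x, continuous (r g ^~ u)}.

Let string u : 0 < u -> forall N n : nat, (0 < N)%N -> n.+3%:R / N%:R = rec N u n.+3 *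
  (1 + u * string_sum (rec N u n.+1) (rec N u n.+2) (rec N u n.+3) (rec N u n.+4)
    (rec N u n.+4.+1)).
Proof.
move=> u0 N n N0.
exact: (sextic_string_equation N0 u0 (P_orth N0 u0) (P_rec N0 u0)).
Qed.

Let expn u : 0 < u < eps -> exists C : R, exists N0 : nat, forall N n : nat,
  (0 < N)%N -> (N0 <= N)%N -> `|n%:R / N%:R - 1| < eps ->
  `|rec N u n - (r 0 (n%:R / N%:R) u + r 1 (n%:R / N%:R) u * N%:R ^- 2
     + r 2 (n%:R / N%:R) u * N%:R ^- 4)| <= C * N%:R ^- 6.
Proof.
move=> /andP[u0 ue].
have [|C [N0 h]] := @r_exp u _ 2; first by rewrite u0 (lt_le_trans ue).
exists C, N0 => N n Np NN ne.
have := h N n Np NN (lt_le_trans ne eps_delta).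
by rewrite !big_ord_recr big_ord0/= add0r !muln0 expr0 invr1 mulr1.
Qed.

Let cont g u : (g < 3)%N -> 0 < u < eps ->
  forall x, `|x - 1| < eps -> {for x, continuous (r g ^~ u)}.
Proof.
by move=> g3 /andP[u0 ue] x xe; apply: r_cont => //; rewrite gtr0_norm.
Qed.

Lemma genus_equations u x : 0 < u < eps -> `|x - 1| < eps ->
  let y := r 0 x u in let v := 10 * u * y ^+ 2 in
  [/\ y + 10 * u * y ^+ 3 = x,
    r 1 x u * (1 + 30 * u * y ^+ 2) ^+ 4 = - (5 * u * y * (1 - 90 * u * y ^+ 2)) &
    r 2 x u * (1 + 30 * u * y ^+ 2) ^+ 9 = 5 * u ^+ 2 * y * (59 * (1 + v) ^+ 3
    - (4 * 10 ^+ 3 + 11) * v * (1 + v) ^+ 2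
    + (27 * 10 ^+ 3 + 528) * v ^+ 2 * (1 + v) - (34 * 10 ^+ 3 + 268) * v ^+ 3)].
Proof.
move=> ue xe; have /andP[u0 _] := ue.
have S N n := @string u u0 N n.
have C0 := @cont 0 u isT ue; have C1 := @cont 1 u isT ue; have C2 := @cont 2 u isT ue.
split.
- exact: (genus0_equation u0 eps1 (rec := rec^~ u) S C0 C1 C2 (expn ue) xe).
- exact: (genus1_equation u0 eps1 (rec := rec^~ u) S C0 C1 C2 (expn ue) xe).
- exact: (genus2_equation u0 eps1 (rec := rec^~ u) S C0 C1 C2 (expn ue) xe).
Qed.
End Topological.

Theorem theoremA2 (R : realType)
    (P : nat -> R -> nat -> {poly R}) (rec : nat -> R -> nat -> R)
    (r : nat -> R -> R -> R)
    (P_orth : forall (N : nat) (u : R), (0 < N)%N -> 0 < u ->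
       monic_orthogonal (sextic_weight N u) (P N u))
    (P_rec : forall (N : nat) (u : R), (0 < N)%N -> 0 < u ->
       recurrence_coefs (P N u) (rec N u))
    (r_analytic : forall g : nat, analytic_near (r g) 1 0)
    (r_expansion : topological_expansion rec r) :
  \forall x \near (1 : R) & u \near (0 : R),
    [/\ \sum_(0 <= j < n) beta0 j x * u ^+ j @[n --> \oo] --> r 0%N x u,
        \sum_(1 <= j < n) beta2 j x * u ^+ j @[n --> \oo] --> r 1%N x u
      & \sum_(2 <= j < n) beta4 j x * u ^+ j @[n --> \oo] --> r 2%N x u].
Proof.
have [delta delta0 r_exp] := r_expansion.
have [c0 [rho0 rho0_gt0 h0]] := r_analytic 0%N.
have [c1 [rho1 rho1_gt0 h1]] := r_analytic 1%N.
have [c2 [rho2 rho2_gt0 h2]] := r_analytic 2%N.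
(* The bound 1 forces x > 0, which fixes the sign of r_0 and makes x a limit of fractions of natural
   numbers. *)
pose eps := Num.min 1 (Num.min delta (Num.min rho0 (Num.min rho1 rho2))).
have eps0 : 0 < eps by rewrite !lt_min ltr01 delta0 rho0_gt0 rho1_gt0.
have [eps1 [eps_delta [e0 [e1 e2]]]] : eps <= 1 /\ eps <= delta /\ eps <= rho0
    /\ eps <= rho1 /\ eps <= rho2.
  by rewrite !ge_min !lexx !orbT.
have r_cont g x u : (g < 3)%N -> `|x - 1| < eps -> `|u| < eps ->
    {for x, continuous (r g ^~ u)}.
  move=> + xe ue; rewrite -[u in `|u|]subr0 in ue.
  case: g => [|[|[|//]]] _.
  - by apply: (analytic_continuous rho0_gt0 h0); [exact: lt_le_trans xe e0|exact: lt_le_trans ue e0].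
  - by apply: (analytic_continuous rho1_gt0 h1); [exact: lt_le_trans xe e1|exact: lt_le_trans ue e1].
  - by apply: (analytic_continuous rho2_gt0 h2); [exact: lt_le_trans xe e2|exact: lt_le_trans ue e2].
have geq := genus_equations P_orth P_rec r_exp eps1 eps_delta r_cont.
near=> x u.
have xe : `|x - 1| < eps.
  near: x; apply: filterS (nbhsx_ballx (1 : R) eps eps0) => z.
  by rewrite /ball/= distrC.
have ue : `|u| < eps.
  near: u; apply: filterS (nbhsx_ballx (0 : R) eps eps0) => z.
  by rewrite /ball/= sub0r normrN.
have x0 : 0 < x by move: xe; rewrite ltr_norml; lra.
have xN0 : x != 0 by rewrite gt_eqF.
have u_eps : \forall v \near (0 : R)^'+, 0 < v < eps.
  by near=> v; apply/andP; split => //; near: v; exact: nbhs_right_lt.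
have E0 : \forall v \near (0 : R)^'+, r 0%N x v + 10 * v * r 0%N x v ^+ 3 = x.
  by apply: filterS u_eps => v /(geq v x)/(_ xe)[].
have E1 : \forall v \near (0 : R)^'+, r 1%N x v * (1 + 30 * v * r 0%N x v ^+ 2) ^+ 4
    = - (5 * v * r 0%N x v * (1 - 90 * v * r 0%N x v ^+ 2)).
  by apply: filterS u_eps => v /(geq v x)/(_ xe)[].
have E2 : \forall v \near (0 : R)^'+, let w := 10 * v * r 0%N x v ^+ 2 in
    r 2%N x v * (1 + 30 * v * r 0%N x v ^+ 2) ^+ 9 = 5 * v ^+ 2 * r 0%N x v *
    (59 * (1 + w) ^+ 3 - (4 * 10 ^+ 3 + 11) * w * (1 + w) ^+ 2
    + (27 * 10 ^+ 3 + 528) * w ^+ 2 * (1 + w) - (34 * 10 ^+ 3 + 268) * w ^+ 3).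
  by apply: filterS u_eps => v /(geq v x)/(_ xe)[].
split.
- have h := analytic_expansion rho0_gt0 h0 (lt_le_trans xe e0)
    (genus0_asym x0 E0) (lt_le_trans ue e0).
  apply: (cvg_near_eq h) => //; apply: nearW => n; rewrite big_mkord.
  by apply: eq_bigr => j _; rewrite beta0E.
- have h := analytic_expansion rho1_gt0 h1 (lt_le_trans xe e1)
    (genus1_asym x0 E0 E1) (lt_le_trans ue e1).
  (* The term j = 0, zero because [tree_coef] vanishes for m > j, is split off once the range is
     nonempty. *)
  apply: (cvg_near_eq h) => //; exists 1%N => // n /= n1.
  rewrite -(big_mkord xpredT (fun j => (- (10 * x ^+ 2)) ^+ j *
    ((2 * x)^-1 * (10 * tree_coef R 3 2 j + tree_coef R 3 1 j)) * u ^+ j)) big_ltn//.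
  rewrite !tree_coef_small// !(mulr0, addr0, mul0r, add0r).
  by apply: eq_big_nat => j /andP[j1 _]; rewrite beta2E.
- have h := analytic_expansion rho2_gt0 h2 (lt_le_trans xe e2)
    (genus2_asym x0 E0 E2) (lt_le_trans ue e2).
  apply: (cvg_near_eq h) => //; exists 2%N => // n /= n2.
  rewrite -(big_mkord xpredT (fun j => (- (10 * x ^+ 2)) ^+ j *
    ((20 * x ^+ 3)^-1 * (59 * tree_coef R 8 2 j
    + (4 * 10 ^+ 3 + 11) * tree_coef R 8 3 j + (27 * 10 ^+ 3 + 528) * tree_coef R 8 4 j
    + (34 * 10 ^+ 3 + 268) * tree_coef R 8 5 j)) * u ^+ j)).
  rewrite big_ltn 1?ltnW// big_ltn//.
  rewrite !(@tree_coef_small _ _ _ 0)// !(@tree_coef_small _ _ _ 1)//.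
  rewrite !(mulr0, addr0, mul0r, add0r).
  by apply: eq_big_nat => j /andP[j1 _]; rewrite beta4E.
Unshelve. all: by end_near. Qed.
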